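(* For every integer $N\ge 1$, every $p_1\in(1,\infty)$ and every $\theta\in(0,1)$, there exists a constant $C=C(N,p_1,\theta)$ such that for all $s_1\in(0,1)$ with $s_1p_1\ge 1$, we have $$\left[\frac{u(x)-u(y)}{|x-y|^{\frac{N}{p}+s}}\right]_{L^{p,\frac{p_1}{\theta}}(\mathbb{R}^N\times\mathbb{R}^N)}\le C\,|u|_{W^{s_1,p_1}(\mathbb{R}^N)}^{\theta}\,\|\nabla u\|_{L^1(\mathbb{R}^N)}^{1-\theta}\qquad\text{for all }u\in C_c^\infty(\mathbb{R}^N),$$ where $0<s<1$ and $1<p<\infty$ are defined by $$s=\theta s_1+(1-\theta)\qquad\text{and}\qquad\frac1p=\frac{\theta}{p_1}+(1-\theta).$$
   Context: $C_c^\infty(\mathbb{R}^N)$ is the space of real-valued smooth compactly supported functions on $\mathbb{R}^N$, and $\mathcal{L}^{2N}$ is Lebesgue measure on $\mathbb{R}^N\times\mathbb{R}^N$. For a measurable function $f$ on $\mathbb{R}^N\times\mathbb{R}^N$ and $1\le p<\infty$, $1\le q<\infty$, the Lorentz quasi-norm is defined by $$[f]_{L^{p,q}(\mathbb{R}^N\times\mathbb{R}^N)}^q=p\int_0^\infty\lambda^q\,\mathcal{L}^{2N}\bigl(\{(x,y)\in\mathbb{R}^N\times\mathbb{R}^N:\ |f(x,y)|\ge\lambda\}\bigr)^{\frac{q}{p}}\frac{d\lambda}{\lambda}.$$ For $0<\sigma<1$ and $1\le r<\infty$ the Gagliardo semi-norm is defined by $$|u|_{W^{\sigma,r}(\mathbb{R}^N)}^r=\iint_{\mathbb{R}^N\times\mathbb{R}^N}\frac{|u(x)-u(y)|^r}{|x-y|^{N+\sigma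 r}}\,dy\,dx.$$ The quotient in the claim is regarded as a function of $(x,y)$, defined for $x\ne y$. *)

(* Defs.v *)
From HB Require Import structures.
From mathcomp Require Import all_boot all_order all_algebra.
From mathcomp Require Import all_classical all_reals all_analysis.

Set Implicit Arguments.
Unset Strict Implicit.
Unset Printing Implicit Defensive.

Import Order.TTheory GRing.Theory Num.Theory.
Import numFieldNormedType.Exports.

Local Open Scope classical_set_scope.
Local Open Scope ring_scope.

(* R^n is 'rV[R]_n, with the sigma-algebra generated by the coordinates, i.e.
   the Borel sigma-algebra. The norm `|x| that the library puts on matrices is
   the sup norm; the Euclidean norm is enorm below. *)

Section rV_measurable.
Variables (R : realType) (n : nat).

Let coor : 'I_n -> 'rV[R]_n -> measurableTypeR R := fun i x => x ord0 i.

Definition rV_display : measure_display. Proof. exact: default_measure_display. Qed.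

Let rV_set0 : g_sigma_preimage coor set0.
Proof. exact: sigma_algebra0. Qed.

Let rV_setC A : g_sigma_preimage coor A -> g_sigma_preimage coor (~` A).
Proof. exact: sigma_algebraC. Qed.

Let rV_bigcup (F : _^nat) : (forall i, g_sigma_preimage coor (F i)) ->
  g_sigma_preimage coor (\bigcup_i (F i)).
Proof. exact: sigma_algebra_bigcup. Qed.

HB.instance Definition _ := @isMeasurable.Build rV_display
  'rV[R]_n (g_sigma_preimage coor) rV_set0 rV_setC rV_bigcup.

Lemma measurable_coord (i : 'I_n) :
  measurable_fun [set: 'rV[R]_n] (fun x => x ord0 i : measurableTypeR R).
Proof.
move=> _ Y mY; rewrite setTI; apply: sub_sigma_algebra => /=.
rewrite -bigcup_seq/=; exists i => /=; first by rewrite mem_index_enum.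
by exists Y => //; rewrite setTI.
Qed.

Lemma measurable_fun_rVP d (T : measurableType d) (f : T -> 'rV[R]_n) :
  (forall i, measurable_fun [set: T] (fun x => f x ord0 i : measurableTypeR R)) ->
  measurable_fun [set: T] f.
Proof.
move=> mf; suff fS : g_sigma_preimage (fun i => coor i \o f) `<=` measurable.
  move=> _ A mA; apply: fS; rewrite g_sigma_preimage_comp.
  by exists A.
apply: smallest_sub; first exact: sigma_algebra_measurable.
rewrite -bigcup_seq; apply: bigcup_sub => i _.
by move=> A [B mB <-]; exact: mf.
Qed.

End rV_measurable.

Lemma sigma_finite_prod d1 d2 (T1 : measurableType d1) (T2 : measurableType d2)
    (R : realType) (m1 : {sigma_finite_measure set T1 -> \bar R})
    (m2 : {sigma_finite_measure set T2 -> \bar R}) :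
  sigma_finite setT (m1 \x m2)%E.
Proof.
have /sigma_finiteP[F [TF ndF Foo]] := sigma_finiteT m1.
have /sigma_finiteP[G [TG ndG Goo]] := sigma_finiteT m2.
exists (fun n => F n `*` G n).
  rewrite -setXTT TF TG predeqE => -[x y]; split.
    move=> [/= [n _ Fnx] [k _ Gky]]; exists (maxn n k) => //; split.
    - by move: x Fnx; exact/subsetPset/ndF/leq_maxl.
    - by move: y Gky; exact/subsetPset/ndG/leq_maxr.
  by move=> [n _ []/= ? ?]; split; exists n.
move=> k; have [? ?] := Foo k; have [? ?] := Goo k.
split; first exact: measurableX.
by rewrite product_measure1E// lte_mul_pinfty// ge0_fin_numE.
Qed.

Section lebesgue_rV.
Variable R : realType.

Definition rV_cons n (z : measurableTypeR R * 'rV[R]_n) : 'rV[R]_n.+1 :=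
  row_mx (z.1%:M : 'rV[R]_1) z.2.

Definition rV_uncons n (x : 'rV[R]_n.+1) : measurableTypeR R * 'rV[R]_n :=
  (x ord0 ord0, \row_j x ord0 (lift ord0 j)).

Lemma rV_cons0 n z : @rV_cons n z ord0 ord0 = z.1.
Proof.
have -> : ord0 = lshift n (ord0 : 'I_1) :> 'I_n.+1 by exact: val_inj.
by rewrite /rV_cons (row_mxEl (z.1%:M : 'rV[R]_1)) mxE.
Qed.

Lemma rV_consS n z j : @rV_cons n z ord0 (lift ord0 j) = z.2 ord0 j.
Proof.
have -> : lift ord0 j = rshift 1 j :> 'I_n.+1 by exact: val_inj.
by rewrite /rV_cons (row_mxEr (z.1%:M : 'rV[R]_1)).
Qed.

Lemma rV_consK n : cancel (@rV_cons n) (@rV_uncons n).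
Proof.
move=> [a y]; rewrite /rV_uncons rV_cons0; congr (_, _).
by apply/rowP => j; rewrite mxE rV_consS.
Qed.

Lemma measurable_rV_cons n : measurable_fun setT (@rV_cons n).
Proof.
apply: measurable_fun_rVP => i.
have [j ->|->] := unliftP ord0 i.
  under eq_fun do rewrite rV_consS.
  exact: (measurableT_comp (@measurable_coord R n j) measurable_snd).
under eq_fun do rewrite rV_cons0.
exact: measurable_fst.
Qed.

Lemma measurable_rV_uncons n : measurable_fun setT (@rV_uncons n).
Proof.
apply: measurable_fun_pair; first exact: measurable_coord.
apply: measurable_fun_rVP => j; under eq_fun do rewrite mxE.
exact: measurable_coord.
Qed.

Section lebesgue_rVS.
Local Open Scope ereal_scope.
Variables (n : nat) (m : {sigma_finite_measure set 'rV[R]_n -> \bar R}).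

Definition lebesgue_rVS : set 'rV[R]_n.+1 -> \bar R :=
  pushforward (@lebesgue_measure R \x m) (@rV_cons n).

Let mcons := @measurable_rV_cons n.

Let lebesgue_rVS0 : lebesgue_rVS set0 = 0.
Proof. exact: measure0. Qed.

Let lebesgue_rVS_ge0 A : 0 <= lebesgue_rVS A.
Proof. exact: measure_ge0. Qed.

Let lebesgue_rVS_sigma_additive : semi_sigma_additive lebesgue_rVS.
Proof. exact: measure_semi_sigma_additive. Qed.

HB.instance Definition _ := isMeasure.Build _ _ _ lebesgue_rVS
  lebesgue_rVS0 lebesgue_rVS_ge0 lebesgue_rVS_sigma_additive.

Let lebesgue_rVS_sigma_finite : sigma_finite setT lebesgue_rVS.
Proof.
have [F UF mF] := sigma_finite_prod (@lebesgue_measure R) m.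
exists (fun k => @rV_uncons n @^-1` F k).
  by rewrite -preimage_bigcup -UF preimage_setT.
move=> k; have [mFk Fk] := mF k; split.
  by rewrite -[X in measurable X]setTI; exact: measurable_rV_uncons.
rewrite /lebesgue_rVS /pushforward -comp_preimage.
by rewrite (_ : _ \o _ = id) //; apply/funext => z; exact: rV_consK.
Qed.

HB.instance Definition _ := Measure_isSigmaFinite.Build _ _ _ lebesgue_rVS
  lebesgue_rVS_sigma_finite.

End lebesgue_rVS.

(* L^0 is the unit mass on the point 'rV[R]_0, and L^(n+1) is the image of
   L^1 x L^n under (a, y) |-> row_mx a y. *)
Fixpoint lebesgue_rV n : {sigma_finite_measure set 'rV[R]_n -> \bar R} :=
  match n with
  | 0 => \d_(0 : 'rV[R]_0)
  | k.+1 => lebesgue_rVS (lebesgue_rV k)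
  end.

Lemma lebesgue_rV_box n (A : 'I_n -> set (measurableTypeR R)) :
  (forall i, measurable (A i)) ->
  lebesgue_rV n [set x : 'rV[R]_n | forall i, A i (x ord0 i)] =
  (\prod_(i < n) lebesgue_measure (A i))%E.
Proof.
elim: n A => [|n IHn] A mA.
  rewrite big_ord0; have -> : [set x : 'rV[R]_0 | forall i, A i (x ord0 i)] = setT.
    by apply/seteqP; split => // x _ [].
  exact: diracT.
rewrite big_ord_recl -IHn//= /lebesgue_rVS /pushforward.
rewrite -product_measure1E//; last first.
  have -> : [set x : 'rV[R]_n | forall i, A (lift ord0 i) (x ord0 i)] =
      \bigcap_(i in [set: 'I_n])
        ((fun x : 'rV[R]_n => x ord0 i) @^-1` A (lift ord0 i)).
    by apply/seteqP; split => x /= Ax i; [move=> _|]; exact: Ax.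
  apply: fin_bigcap_measurable => // i _.
  by rewrite -[X in measurable X]setTI; exact: (@measurable_coord R n i).
congr (product_measure1 _ _ _); apply/seteqP; split => -[a y] /=.
  move=> Ax; split; first by have := Ax ord0; rewrite rV_cons0.
  by move=> i; have := Ax (lift ord0 i); rewrite rV_consS.
move=> [Aa Ay] i.
by have [j ->|->] := unliftP ord0 i; rewrite ?rV_consS ?rV_cons0//; exact: Ay.
Qed.

End lebesgue_rV.

Section function_spaces.
Variables (R : realType) (N : nat).
Implicit Types u : 'rV[R]_N -> R.

Definition enorm (x : 'rV[R]_N) : R := Num.sqrt (\sum_i x ord0 i ^+ 2).

Definition partial (i : 'I_N) u : 'rV[R]_N -> R :=
  fun x => 'D_(delta_mx ord0 i) u x.

Definition gradient u : 'rV[R]_N -> 'rV[R]_N :=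
  fun x => \row_i partial i u x.

(* foldr partial u s is the iterated partial derivative of u along the list s
   of directions. *)
Definition smooth u : Prop := forall s : seq 'I_N,
  continuous (foldr partial u s) /\
  forall (i : 'I_N) (x : 'rV[R]_N),
    derivable (foldr partial u s) x (delta_mx ord0 i).

Definition smooth_compact_support u : Prop :=
  smooth u /\ compact (closure [set x | u x != 0]).

Definition gagliardo (sigma r : R) u : \bar R :=
  ((\int[lebesgue_rV R N \x lebesgue_rV R N]_z
      (`|u z.1 - u z.2| `^ r / enorm (z.1 - z.2) `^ (N%:R + sigma * r))%R%:E)
   `^ r^-1)%E.

Definition grad_L1 u : \bar R :=
  ('N[lebesgue_rV R N]_1[EFin \o (enorm \o gradient u)])%E.

(* On the diagonal the quotient is 0 / 0 = 0, so the diagonal lies in no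
   superlevel set [set z | t <= `|f z|] with 0 < t. *)
Definition diff_quotient (a : R) u (z : 'rV[R]_N * 'rV[R]_N) : R :=
  (u z.1 - u z.2) / enorm (z.1 - z.2) `^ a.

End function_spaces.

(* The measure of the superlevel set may be infinite, so the integral and the
   quasi-norm take values in \bar R. *)
Definition lorentz_norm d (T : measurableType d) (R : realType)
    (mu : {measure set T -> \bar R}) (p q : R) (f : T -> R) : \bar R :=
  ((p%:E * \int[lebesgue_measure]_(t in `]0%R, +oo[)
      ((t `^ q)%R%:E * mu [set z | t <= `|f z|]%R `^ (q / p) * (t^-1)%R%:E))
   `^ q^-1)%E.

(* Main.v *)
(* With f1 the quotient of exponent N/p1 + s1 and f0 the one of exponent N + 1,
   |f| = |f1|^theta |f0|^(1-theta). The L^p1 norm of f1 is the Gagliardo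
   semi-norm, and f0 is in weak L^1 with norm at most C(N) |grad u|_1, so a
   Hoelder inequality in Lorentz spaces concludes; its constant only depends on
   p and p1/theta, hence neither on s1 nor on u.
   For the weak bound, join x to y along the axes: on one of the edges u varies
   by at least (l/N) |x-y|^(N+1) if l <= |f0 (x, y)|. For the i-th edge, fix the
   line it lies on: it is close to a dyadic cell Q of the line, of length
   comparable to |x-y| and with |Q|^(N+1) <= C/l * (integral over Q of |d_i u|).
   The maximal cells of this kind are disjoint, and the pairs close to Q have
   measure at most C |Q|^(N+1), so summing over the maximal cells and
   integrating over the lines gives the bound. *)
From HB Require Import structures.
Require Import Defs.
From mathcomp Require Import all_boot all_order all_algebra.
From mathcomp Require Import all_classical all_reals all_analysis.
From mathcomp Require Import measurable_realfun.
From mathcomp Require Import lra ring.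

Import Order.TTheory GRing.Theory Num.Theory.
Import numFieldNormedType.Exports.

Local Open Scope classical_set_scope.
Local Open Scope ring_scope.

Set Implicit Arguments.
Unset Strict Implicit.
Unset Printing Implicit Defensive.

(** * Measures determined by their values on coordinate boxes *)

Section coordinate_boxes.
Variables (R : realType) (d : measure_display) (T : measurableType d).
Variables (I : finType) (c : I -> T -> measurableTypeR R).

(** The coordinates form an arbitrary finite family [c], so that the same argument serves for R^n
    and for R^n x R^n. *)
Definition cbox (A : I -> set (measurableTypeR R)) : set T :=
  [set t | forall i, A i (c i t)].

Hypothesis mc : forall i, measurable_fun setT (c i).

Lemma measurable_cbox A : (forall i, measurable (A i)) -> measurable (cbox A).
Proof.
move=> mA; have -> : cbox A = \bigcap_(i in [set: I]) (c i @^-1` A i).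
  by apply/seteqP; split => x /= Ax i; [move=> _|]; exact: Ax.
apply: fin_bigcap_measurable => // i _.
by rewrite -[X in measurable X]setTI; exact: mc.
Qed.

Hypothesis generated : forall d' (T' : measurableType d') (f : T' -> T),
  (forall i, measurable_fun setT (c i \o f)) -> measurable_fun setT f.

(** Boxes are stable under intersection. By [generated], applied to the identity out of the
    sigma-algebra that the boxes generate, they generate every measurable set. The cubes with sides
    [-n, n] exhaust the space and have finite measure, so the pi-system uniqueness theorem
    applies. *)
Lemma cbox_measure_unique (m1 m2 : {measure set T -> \bar R}) :
  (forall A, (forall i, measurable (A i)) -> m1 (cbox A) = m2 (cbox A)) ->
  (forall A, (forall i, measurable (A i)) ->
    (forall i, lebesgue_measure (A i) < +oo)%E -> (m1 (cbox A) < +oo)%E) ->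
  forall X, measurable X -> m1 X = m2 X.
Proof.
move=> m12 m1oo X mX.
pose G : set (set T) := [set cbox A | A in [set A | forall i, measurable (A i)]].
pose g (n : nat) := cbox (fun _ => `[- n%:R, n%:R]%classic).
have Gg n : G (g n) by eexists; last reflexivity.
apply: (measure_unique G g) => //.
- apply/seteqP; split.
    have midT : measurable_fun [set: g_sigma_algebraType G]
        (id : g_sigma_algebraType G -> T).
      apply: generated => i _ Y mY; rewrite setTI.
      apply: sub_sigma_algebra; exists (fun j => if j == i then Y else setT).
        by move=> j; case: eqP.
      apply/seteqP; split => t /=.
        by move=> /(_ i); rewrite eqxx.
      by move=> Yt j; case: eqP => // ->.
    by move=> Y mY; have := midT measurableT Y mY; rewrite setTI.
  apply: smallest_sub; first exact: sigma_algebra_measurable.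
  by move=> _ [A mA <-]; exact: measurable_cbox.
- move=> _ _ [A mA <-] [B mB <-]; exists (fun i => A i `&` B i).
    by move=> i; exact: measurableI.
  apply/seteqP; split => t /=.
    by move=> AB; split => i; have [] := AB i.
  by move=> [At Bt] i; split; [exact: At|exact: Bt].
- apply/seteqP; split => // t _.
  pose M := \sum_i `|c i t|.
  exists (Num.truncn M).+1 => // i /=.
  rewrite in_itv/= -ler_norml.
  have : `|c i t| <= M by rewrite /M (bigD1 i)//= lerDl sumr_ge0.
  by move=> /le_trans; apply; exact/ltW/truncnS_gt.
- by move=> _ [A mA <-]; exact: m12.
- move=> n; apply: m1oo => // i; rewrite lebesgue_measure_itv/=.
  by case: ifP => // _; rewrite -EFinB ltry.
Qed.

End coordinate_boxes.

Section rV_boxes.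
Variables (R : realType).

Definition rV_box n (A : 'I_n -> set (measurableTypeR R)) : set 'rV[R]_n :=
  [set x | forall i, A i (x ord0 i)].

Lemma measurable_rV_box n (A : 'I_n -> set (measurableTypeR R)) :
  (forall i, measurable (A i)) -> measurable (rV_box A).
Proof.
exact: (@measurable_cbox _ _ _ _ (fun i (x : 'rV[R]_n) => x ord0 i)
  (@measurable_coord R n)).
Qed.

Lemma lebesgue_rV_boxE n (A : 'I_n -> set (measurableTypeR R)) :
  (forall i, measurable (A i)) ->
  lebesgue_rV R n (rV_box A) = (\prod_(i < n) lebesgue_measure (A i))%E.
Proof. exact: lebesgue_rV_box. Qed.

Lemma prode_lty (I : finType) (F : I -> \bar R) :
  (forall i, 0 <= F i)%E -> (forall i, F i < +oo)%E -> (\prod_i F i < +oo)%E.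
Proof.
move=> F0 Foo.
suff : (0 <= \prod_i F i < +oo)%E by case/andP.
apply: (big_ind (fun x => (0 <= x < +oo)%E)) => //.
- by rewrite lee01 ltry.
- move=> x y /andP[x0 xoo] /andP[y0 yoo].
  by rewrite mule_ge0//= lte_mul_pinfty// ge0_fin_numE.
- by move=> i _; rewrite F0 Foo.
Qed.

Lemma rV_box_measure_unique n (m : {measure set 'rV[R]_n -> \bar R}) :
  (forall A, (forall i, measurable (A i)) ->
    m (rV_box A) = (\prod_(i < n) lebesgue_measure (A i))%E) ->
  forall X, measurable X -> m X = lebesgue_rV R n X.
Proof.
move=> mbox; apply: (@cbox_measure_unique _ _ _ _
    (fun i (x : 'rV[R]_n) => x ord0 i) (@measurable_coord R n)).
- by move=> d' T' f; exact: measurable_fun_rVP.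
- by move=> A mA; rewrite mbox// -lebesgue_rV_boxE.
- move=> A mA Aoo; rewrite mbox//.
  by apply: prode_lty => // i; exact: measure_ge0.
Qed.

(** A pair of vectors is one point with coordinates indexed by ['I_n + 'I_n], and its boxes are the
    products of two boxes. *)
Lemma rV_box2_measure_unique n
    (m : {measure set ('rV[R]_n * 'rV[R]_n) -> \bar R}) :
  (forall A B, (forall i, measurable (A i)) -> (forall i, measurable (B i)) ->
    m (rV_box A `*` rV_box B) = (\prod_(i < n) lebesgue_measure (A i) *
      \prod_(i < n) lebesgue_measure (B i))%E) ->
  forall X, measurable X -> m X = (lebesgue_rV R n \x lebesgue_rV R n)%E X.
Proof.
move=> mbox.
pose c (i : 'I_n + 'I_n) (z : 'rV[R]_n * 'rV[R]_n) : measurableTypeR R :=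
  match i with inl i => z.1 ord0 i | inr i => z.2 ord0 i end.
have cE A : cbox c A = rV_box (A \o inl) `*` rV_box (A \o inr).
  apply/seteqP; split => z /=.
    by move=> Az; split=> i; [exact: (Az (inl i))|exact: (Az (inr i))].
  by move=> [A1 A2] [i|i]; [exact: A1|exact: A2].
apply: (@cbox_measure_unique _ _ _ _ c).
- move=> [i|i].
    exact: (measurableT_comp (@measurable_coord R n i) measurable_fst).
  exact: (measurableT_comp (@measurable_coord R n i) measurable_snd).
- move=> d' T' f mf.
  apply/measurable_fun_pairP; split; apply: measurable_fun_rVP => i.
    exact: (mf (inl i)).
  exact: (mf (inr i)).
- move=> A mA; rewrite cE mbox//; [|by move=> i; exact: mA..].
  have mA1 i : measurable ((A \o inl) i) by exact: mA.
  have mA2 i : measurable ((A \o inr) i) by exact: mA.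
  rewrite /= product_measure1E; [|exact: measurable_rV_box|exact: measurable_rV_box].
  by congr (_ * _)%E; apply: esym; exact: lebesgue_rV_boxE.
- move=> A mA Aoo; rewrite cE mbox; [|by move=> i; exact: mA..].
  have P0 (f : 'I_n -> 'I_n + 'I_n) :
      (0 <= \prod_(i < n) lebesgue_measure (A (f i)))%E.
    by apply: prode_ge0 => i _; exact: measure_ge0.
  have Poo (f : 'I_n -> 'I_n + 'I_n) :
      (\prod_(i < n) lebesgue_measure (A (f i)) < +oo)%E.
    by apply: prode_lty => i; [exact: measure_ge0|exact: Aoo].
  apply: lte_mul_pinfty; [exact: P0| |exact: Poo].
  by rewrite ge0_fin_numE; [exact: Poo|exact: P0].
Qed.

End rV_boxes.

(** * Borel measurability of open sets and continuous functions on R^n *)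

Section countable_unions.
Variables (d : measure_display) (T : measurableType d).

Lemma measurable_bigcup_countType (I : countType) (F : I -> set T) :
  (forall i, measurable (F i)) -> measurable (\bigcup_i F i).
Proof.
move=> mF; pose G k := if unpickle k is Some i then F i else set0.
have -> : \bigcup_i F i = \bigcup_k G k.
  apply/seteqP; split => x [i _ Fix]; first by exists (pickle i); rewrite // /G pickleK.
  by move: Fix; rewrite /G; case: unpickle => // j Fjx; exists j.
by apply: bigcupT_measurable => k; rewrite /G; case: unpickle.
Qed.

End countable_unions.

Section rV_open.
Variables (R : realType) (n : nat).

(** An open set is the union of the grid cells of mesh 1/(k+1), for all k, that it contains; there
    are countably many of them, and each is a box. *)
Lemma open_rV_measurable (U : set 'rV[R]_n) : open U -> measurable U.
Proof.
move=> oU.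
pose cell (p : nat * {ffun 'I_n -> int}) : set 'rV[R]_n :=
  rV_box (fun i => [set` `[(p.2 i)%:~R / p.1.+1%:R, ((p.2 i)%:~R + 1) / p.1.+1%:R[]).
pose F p := if `[< cell p `<=` U >] then cell p else set0.
have -> : U = \bigcup_p F p.
  apply/seteqP; split; last first.
    by move=> x [p _]; rewrite /F; case: asboolP => // cU cx; exact: cU.
  move=> x Ux; have /nbhs_ballP[e /= e0 xeU] : nbhs x U by exact: open_nbhs_nbhs.
  (* The mesh 1/(k+1) is below [e], so the grid cell through [x] stays in the sup-norm ball of
     radius [e] around [x]. *)
  pose k := Num.truncn e^-1.
  have ke : k.+1%:R^-1 < e by rewrite invf_plt ?posrE//; exact: truncnS_gt.
  pose q := [ffun i : 'I_n => Num.floor (x ord0 i * k.+1%:R)].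
  have k0 : 0 < k.+1%:R :> R by [].
  exists (k, q) => //; rewrite /F ifT.
    move=> i /=; rewrite in_itv/= ffunE ler_pdivrMr// ltr_pdivlMr//.
    by rewrite floor_le -[1]/(1%:~R) -intrD floorD1_gt.
  apply/asboolP => y cy; apply: xeU; split => // i j; rewrite ord1.
  have := cy j; rewrite /= in_itv/= ffunE.
  set f := Num.floor _ => /andP[y1 y2].
  have x1 : f%:~R / k.+1%:R <= x ord0 j by rewrite ler_pdivrMr// floor_le.
  have x2 : x ord0 j < (f%:~R + 1) / k.+1%:R.
    by rewrite ltr_pdivlMr// -[1]/(1%:~R) -intrD floorD1_gt.
  change (`|x ord0 j - y ord0 j| < e).
  rewrite (le_lt_trans _ ke)// ler_norml.
  have close (a b c r : R) : a <= c -> c < a + b -> a <= r -> r < a + b ->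
    - b <= c - r <= b by move=> *; apply/andP; split; lra.
  by move: x1 x2 y1 y2; rewrite mulrDl mul1r; exact: close.
apply: measurable_bigcup_countType => p; rewrite /F; case: asboolP => // _.
by apply: measurable_rV_box => i; exact: measurable_itv.
Qed.

Lemma continuous_rV_measurable (f : 'rV[R]_n -> R) :
  continuous f -> measurable_fun setT f.
Proof.
move=> /continuousP cf.
apply: (measurability _ (measurable_realfun.RGenOpens.measurableE R)).
move=> _ [_ [a [b ->]] <-]; rewrite setTI; apply: open_rV_measurable.
exact/cf/itv_open.
Qed.

Lemma measurable_enorm : measurable_fun setT (@enorm R n).
Proof.
apply: measurableT_comp.
  by apply: continuous_measurable_fun; exact: sqrt_continuous.
by apply: measurable_sum => i; apply: measurable_funX; exact: measurable_coord.
Qed.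

End rV_open.

(** * Coordinate changes: lines parallel to an axis, and paths along the axes *)

Section rV_insert.
Variables (R : realType) (n : nat).
Implicit Types (i : 'I_n.+1) (a : R) (w : 'rV[R]_n).

Definition rV_ins i a w : 'rV[R]_n.+1 :=
  \row_j (if unlift i j is Some k then w ord0 k else a).

Lemma rV_ins_eq i a w : rV_ins i a w ord0 i = a.
Proof. by rewrite mxE unlift_none. Qed.

Lemma rV_ins_lift i a w k : rV_ins i a w ord0 (lift i k) = w ord0 k.
Proof. by rewrite mxE liftK. Qed.

Lemma measurable_rV_ins d (T : measurableType d) i
    (f : T -> measurableTypeR R) (g : T -> 'rV[R]_n) :
  measurable_fun setT f -> measurable_fun setT g ->
  measurable_fun setT (fun t => rV_ins i (f t) (g t)).
Proof.
move=> mf mg; apply: measurable_fun_rVP => j.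
have [k ->|->] := unliftP i j.
  under eq_fun do rewrite rV_ins_lift.
  exact: (measurableT_comp (@measurable_coord R n k) mg).
by under eq_fun do rewrite rV_ins_eq.
Qed.

End rV_insert.

Section product_sigma_finite.
Context d1 d2 (T1 : measurableType d1) (T2 : measurableType d2) (R : realType).
Variables (m1 : {sigma_finite_measure set T1 -> \bar R})
  (m2 : {sigma_finite_measure set T2 -> \bar R}).

(* The library's canonical sigma-finite structure on m1 \x m2 is keyed on
   subprobabilities, so that the general one has to be put on an alias. *)
Definition product_sf : set (T1 * T2) -> \bar R := (m1 \x m2)%E.

HB.instance Definition _ := Measure.copy product_sf (m1 \x m2)%E.

HB.instance Definition _ := Measure_isSigmaFinite.Build _ _ _ product_sf
  (sigma_finite_prod m1 m2).

End product_sigma_finite.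

Section rV_swaps.
Variables (R : realType) (n : nat) (i : 'I_n.+1).

(* The path from x to y along the axes runs through the points rV_mix k y x. *)
Definition rV_mix m (k : nat) (p q : 'rV[R]_m) : 'rV[R]_m :=
  \row_j (if (j < k)%N then p ord0 j else q ord0 j).

Lemma measurable_rV_mix m d (T : measurableType d) k (f g : T -> 'rV[R]_m) :
  measurable_fun setT f -> measurable_fun setT g ->
  measurable_fun setT (fun t => rV_mix k (f t) (g t)).
Proof.
move=> mf mg; apply: measurable_fun_rVP => j.
under eq_fun do rewrite mxE; case: (j < k)%N.
  exact: (measurableT_comp (@measurable_coord R m j) mf).
exact: (measurableT_comp (@measurable_coord R m j) mg).
Qed.

(** The recursion defining [lebesgue_rV] splits off the first coordinate only. Comparing boxes
    allows any coordinate [i] to be split off, with [w] labelling the lines of direction [i]. *)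
Lemma lebesgue_rV_ins X : measurable X ->
  (lebesgue_rV R n \x @lebesgue_measure R)%E
    ((fun t => rV_ins i t.2 t.1) @^-1` X) = lebesgue_rV R n.+1 X.
Proof.
have mI : measurable_fun setT
    (fun t : 'rV[R]_n * measurableTypeR R => rV_ins i t.2 t.1).
  by apply: measurable_rV_ins; [exact: measurable_snd|exact: measurable_fst].
move: X; apply: (@rV_box_measure_unique _ _
  (measure_function_pushforward__canonical__measure_function_Measure
    (lebesgue_rV R n \x @lebesgue_measure R)%E mI)) => A mA.
rewrite /= /pushforward.
have -> : (fun t : 'rV[R]_n * measurableTypeR R => rV_ins i t.2 t.1) @^-1` rV_box A =
    rV_box (fun k => A (lift i k)) `*` A i.
  apply/seteqP; split => -[w a] /=.
    move=> Aw; split; last by have := Aw i; rewrite rV_ins_eq.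
    by move=> k; have := Aw (lift i k); rewrite rV_ins_lift.
  move=> [Aw Aa] j.
  by have [k ->|->] := unliftP i j; rewrite ?rV_ins_lift ?rV_ins_eq//; exact: Aw.
rewrite product_measure1E//; last exact: measurable_rV_box.
rewrite (bigD1_ord i)//= muleC; congr (_ * _)%E.
by apply: lebesgue_rV_boxE => k; exact: mA.
Qed.

Lemma integral_rV_ins (f : 'rV[R]_n.+1 -> \bar R) :
  measurable_fun setT f -> (forall x, 0 <= f x)%E ->
  (\int[lebesgue_rV R n]_w \int[@lebesgue_measure R]_a f (rV_ins i a w) =
   \int[lebesgue_rV R n.+1]_x f x)%E.
Proof.
move=> mf f0.
have mI : measurable_fun setT
    (fun t : 'rV[R]_n * measurableTypeR R => rV_ins i t.2 t.1).
  by apply: measurable_rV_ins; [exact: measurable_snd|exact: measurable_fst].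
pose m := measure_function_pushforward__canonical__measure_function_Measure
    (lebesgue_rV R n \x @lebesgue_measure R)%E mI.
transitivity (\int[m]_x f x)%E; last first.
  by apply: eq_measure_integral => A mA _; exact: lebesgue_rV_ins.
rewrite ge0_integral_pushforward// preimage_setT.
rewrite (@fubini_tonelli1 _ _ _ _ _ _ _
  (fun t : 'rV[R]_n * measurableTypeR R => f (rV_ins i t.2 t.1)))//.
exact: measurableT_comp.
Qed.

(* Coordinates (w, (a, v)) on the pairs (x, y): v collects the coordinates of x
   before i and those of y from i on. In them the i-th edge of the path from x
   to y joins rV_ins i a w to rV_ins i (v ord0 i) w. *)
Definition rV_path (t : 'rV[R]_n * (measurableTypeR R * 'rV[R]_n.+1)) :
    'rV[R]_n.+1 * 'rV[R]_n.+1 :=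
  let x := rV_ins i t.2.1 t.1 in (rV_mix i t.2.2 x, rV_mix i x t.2.2).

Lemma measurable_rV_path : measurable_fun setT rV_path.
Proof.
have mI : measurable_fun setT
    (fun t : 'rV[R]_n * (measurableTypeR R * 'rV[R]_n.+1) => rV_ins i t.2.1 t.1).
  apply: measurable_rV_ins; last exact: measurable_fst.
  exact: (measurableT_comp measurable_fst measurable_snd).
have m2 : measurable_fun setT
    (fun t : 'rV[R]_n * (measurableTypeR R * 'rV[R]_n.+1) => t.2.2).
  exact: (measurableT_comp measurable_snd measurable_snd).
by apply: measurable_fun_pair; exact: measurable_rV_mix.
Qed.

(** [rV_path] merely permutes the scalar coordinates of a pair of points, so it preserves the
    measure of boxes, hence of all measurable sets. *)
Lemma lebesgue_rV_path X : measurable X ->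
  (lebesgue_rV R n \x product_sf (@lebesgue_measure R) (lebesgue_rV R n.+1))%E
    (rV_path @^-1` X) = (lebesgue_rV R n.+1 \x lebesgue_rV R n.+1)%E X.
Proof.
pose m := measure_function_pushforward__canonical__measure_function_Measure
  (lebesgue_rV R n \x product_sf (@lebesgue_measure R) (lebesgue_rV R n.+1))%E
  measurable_rV_path.
move: X; apply: (@rV_box2_measure_unique _ _ m) => A B mA mB; rewrite /m/= /pushforward.
(* [D] collects the sides that constrain [(w, a)] and [E] those that constrain [v]: the sides of
   index below [i] are exchanged between [A] and [B]. *)
pose D (j : 'I_n.+1) := if (j < i)%N then B j else A j.
pose E (j : 'I_n.+1) := if (j < i)%N then A j else B j.
have mD j : measurable (D j) by rewrite /D; case: ifP.
have mE j : measurable (E j) by rewrite /E; case: ifP.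
have -> : rV_path @^-1` (rV_box A `*` rV_box B) =
    rV_box (fun k => D (lift i k)) `*` (D i `*` rV_box E).
  apply/seteqP; split => -[w [a v]] /=.
    move=> [xA yB].
    have ID j : D j (rV_ins i a w ord0 j).
      rewrite /D; case: ifPn => ji; first by have := yB j; rewrite mxE ji.
      by have := xA j; rewrite mxE (negbTE ji).
    split => [k|]; first by have := ID (lift i k); rewrite rV_ins_lift.
    split => [|j]; first by have := ID i; rewrite rV_ins_eq.
    rewrite /E; case: ifPn => ji; first by have := xA j; rewrite mxE ji.
    by have := yB j; rewrite mxE (negbTE ji).
  move=> [wD [aD vE]].
  have ID j : D j (rV_ins i a w ord0 j).
    have [k ->|->] := unliftP i j; last by rewrite rV_ins_eq.
    by rewrite rV_ins_lift; exact: wD.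
  by split => j; rewrite mxE; have := ID j; have := vE j; rewrite /D /E; case: ifP.
have mbD := measurable_rV_box (fun k => mD (lift i k)).
have mbE := measurable_rV_box mE.
rewrite product_measure1E//; last exact: measurableX.
transitivity ((\prod_(k < n) lebesgue_measure (D (lift i k))) *
    (lebesgue_measure (D i) * \prod_(j < n.+1) lebesgue_measure (E j)))%E.
  congr (_ * _)%E; first exact: lebesgue_rV_boxE.
  rewrite /= /product_sf product_measure1E//; congr (_ * _)%E.
  exact: lebesgue_rV_boxE.
rewrite muleA [X in (X * _)%E]muleC.
rewrite -(@bigD1_ord _ _ _ _ i xpredT (fun j => lebesgue_measure (D j)))//=.
rewrite -!big_split/=; apply: eq_bigr => j _.
by rewrite /D /E; case: ifP => // _; rewrite muleC.
Qed.

End rV_swaps.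

(** * Superlevel sets: measurability, Chebyshev's inequality and null functions *)

Section superlevel_sets.
Context d (T : measurableType d) (R : realType) (mu : {measure set T -> \bar R}).
Implicit Types f g : T -> R.

Lemma measurable_set_ler f g : measurable_fun setT f -> measurable_fun setT g ->
  measurable [set x | f x <= g x].
Proof.
move=> mf mg; rewrite -[X in measurable X]setTI.
exact: (measurable_fun_ler mf mg measurableT (Y := [set true])).
Qed.

Lemma measurable_set_ltr f g : measurable_fun setT f -> measurable_fun setT g ->
  measurable [set x | f x < g x].
Proof.
move=> mf mg; rewrite -[X in measurable X]setTI.
exact: (measurable_fun_ltr mf mg measurableT (Y := [set true])).
Qed.

Lemma chebyshev_powR g (t r : R) : measurable_fun setT g -> 0 <= r -> 0 < t ->
  ((t `^ r)%:E * mu [set x | t <= g x]%R <= \int[mu]_x (g x `^ r)%:E)%E.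
Proof.
move=> mg r0 t0.
have mt : measurable [set x | t <= g x].
  by apply: measurable_set_ler => //; exact: measurable_cst.
have mgr : measurable_fun setT (fun x => (g x `^ r)%:E).
  by apply/measurable_EFinP; exact: (measurableT_comp (measurable_powR _)).
rewrite -integral_cst//.
apply: (@le_trans _ _ (\int[mu]_(x in [set x | (t <= g x)%R]) (g x `^ r)%:E)%E).
  apply: ge0_le_integral => //.
  - by move=> x _; rewrite lee_fin powR_ge0.
  - exact: measurable_funS mgr.
  - move=> x /= tx; rewrite lee_fin ge0_ler_powR// ?nnegrE ?(ltW t0)//.
    exact: le_trans (ltW t0) tx.
by apply: ge0_subset_integral => // x _; rewrite lee_fin powR_ge0.
Qed.

(** Serves the degenerate cases of the Hoelder inequality, where one factor vanishes almost
    everywhere. *)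
Lemma null_support g : measurable_fun setT g ->
  (forall t, 0 < t -> mu [set x | t <= g x] = 0%E) -> mu [set x | 0 < g x] = 0%E.
Proof.
move=> mg g0.
pose G (n : nat) := [set x | n.+1%:R^-1 <= g x].
have mG n : measurable (G n).
  by apply: measurable_set_ler => //; exact: measurable_cst.
apply/eqP; rewrite eq_le measure_ge0 andbT.
apply: (@le_trans _ _ (mu (\bigcup_n G n))).
  apply: le_measure; rewrite ?inE.
  - by apply: measurable_set_ltr => //; exact: measurable_cst.
  - exact: bigcupT_measurable.
  - move=> x /= gx; exists (Num.truncn (g x)^-1) => //; rewrite /G/=.
    by rewrite invf_ple ?posrE// ltW// truncnS_gt.
apply: (le_trans (generalized_Boole_inequality _ _ _)) => //.
  exact: bigcupT_measurable.
by rewrite eseries0// => n _ _; exact: g0.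
Qed.

Lemma lorentz_norm_eq0 (p q : R) f : q != 0 -> p != 0 ->
  (forall t, 0 < t -> mu [set z | t <= `|f z|] = 0%E) ->
  lorentz_norm mu p q f = 0%E.
Proof.
move=> q0 p0 f0; rewrite /lorentz_norm integral0_eq ?mule0 ?poweR0r ?invr_neq0//.
move=> t /=; rewrite in_itv/= andbT => t0.
by rewrite f0// poweR0r ?mulf_neq0 ?invr_neq0// mule0 mul0e.
Qed.

End superlevel_sets.

(** * Hoelder's inequality between L^p1 and weak L^1, with values in a Lorentz space *)

Section lorentz_hoelder.
Context d (T : measurableType d) (R : realType)
  (mu : {sigma_finite_measure set T -> \bar R}).
Variables (p1 theta p : R) (f g0 g1 : T -> R).
Hypotheses (p1_gt1 : 1 < p1) (theta01 : 0 < theta < 1).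
Hypothesis pE : p^-1 = theta / p1 + (1 - theta).
Hypotheses (mf : measurable_fun setT f) (mg0 : measurable_fun setT g0)
  (mg1 : measurable_fun setT g1).
Hypotheses (g0_ge0 : forall z, 0 <= g0 z) (g1_ge0 : forall z, 0 <= g1 z).
Hypothesis fE : forall z, `|f z| = g1 z `^ theta * g0 z `^ (1 - theta).

Let q := p1 / theta.
Let theta_gt0 : 0 < theta. Proof. by case/andP: theta01. Qed.
Let theta_lt1 : 0 < 1 - theta. Proof. by case/andP: theta01; rewrite subr_gt0. Qed.
Let p1_gt0 : 0 < p1. Proof. exact: lt_trans p1_gt1. Qed.
Let q_gt1 : 1 < q.
Proof. by rewrite /q ltr_pdivlMr// mul1r (lt_trans _ p1_gt1)//; case/andP: theta01. Qed.
Let q_gt0 : 0 < q. Proof. exact: lt_trans q_gt1. Qed.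
Let p_gt0 : 0 < p.
Proof. by rewrite -invr_gt0 pE addr_gt0// divr_gt0. Qed.

Let qpE : q / p = 1 + q * (1 - theta).
Proof. by rewrite pE /q; field; rewrite !gt_eqF. Qed.

Let phi t := mu [set z | t <= `|f z|].

Let mnf : measurable_fun setT (fun z => `|f z|).
Proof. exact: measurableT_comp. Qed.

Let msup t : measurable [set z | t <= `|f z|].
Proof. by apply: measurable_set_ler => //; exact: measurable_cst. Qed.

(** [phi t] is the measure of the section at [t] of a measurable subset of the product, and [mu] is
    sigma-finite. *)
Let mphi : measurable_fun setT phi.
Proof.
pose A : set (R * T) := [set x | x.1 <= `|f x.2|].
have mA : measurable A.
  apply: measurable_set_ler; first exact: measurable_fst.
  exact: (measurableT_comp mnf measurable_snd).
rewrite (_ : phi = mu \o xsection A); first exact: measurable_fun_xsection.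
by apply/funext => t; rewrite /phi/= xsectionE.
Qed.

Let r := q * (1 - theta).

Let r_gt0 : 0 < r. Proof. exact: mulr_gt0. Qed.

(** Since the exponents [theta] and [1 - theta] add up to 1, [|f z|] is below [t] wherever [g0 z]
    and [g1 z] both are. Hence the superlevel set is covered by those of [g1] and [g0], which are
    finite by Chebyshev's inequality and by the weak bound. *)
Lemma superlevel_lty (a t : R) : 0 < t -> (mu [set z | t <= g0 z]%R <= a%:E)%E ->
  (\int[mu]_z (g1 z `^ p1)%:E < +oo)%E -> (mu [set z | t <= `|f z|]%R < +oo)%E.
Proof.
move=> t0 weak Ioo.
have m0 : measurable [set z | t <= g0 z].
  by apply: measurable_set_ler => //; exact: measurable_cst.
have m1 : measurable [set z | t <= g1 z].
  by apply: measurable_set_ler => //; exact: measurable_cst.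
apply: (@le_lt_trans _ _ (mu ([set z | t <= g1 z] `|` [set z | t <= g0 z]))).
  apply: le_measure; rewrite ?inE//; first exact: measurableU.
  move=> z /=; rewrite fE => tf.
  have [|tg1] := leP t (g1 z); [by left|].
  have [|tg0] := leP t (g0 z); [by right|].
  move: tf; rewrite leNgt => /negP; case.
  have -> : t = t `^ theta * t `^ (1 - theta).
    by rewrite -powRD addrC subrK ?powRr1 ?ltW// oner_eq0.
  by apply: ltr_pM; rewrite ?powR_ge0// gt0_ltr_powR// ?nnegrE// ltW.
apply: (le_lt_trans (measureU2 mu m1 m0)); rewrite lte_add_pinfty//; last first.
  exact: le_lt_trans weak (ltry _).
rewrite ltey; apply: contraTneq (chebyshev_powR mu mg1 (ltW p1_gt0) t0) => ->.
by rewrite gt0_muley ?lte_fin ?powR_gt0// leNgt Ioo.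
Qed.

(* At least half of {t <= |f|} lies in {g0 < 2a / phi t}. Hence the integrand
   t^(q-1) phi(t)^(q/p) is at most twice the integral over z of
   t^(q-1) phi(t)^(q/p-1) on {t <= |f|, g0 phi(t) < 2a}. After Tonelli,
   phi(t) < 2a / g0 z and q/p - 1 = q (1 - theta) leave only g1^p1. *)
Lemma lorentz_hoelder_fin (a : R) : 0 < a ->
  (forall t, 0 < t -> (mu [set z | t <= g0 z]%R <= (a / t)%:E)%E) ->
  (\int[mu]_z (g1 z `^ p1)%:E < +oo)%E ->
  (lorentz_norm mu p q f <=
   ((2 * p * (2 * a) `^ (q * (1 - theta)))%:E * \int[mu]_z (g1 z `^ p1)%:E) `^ q^-1)%E.
Proof.
move=> a0 weak Ioo; rewrite -/r.
have phioo (t : R) : 0 < t -> (phi t < +oo)%E.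
  by move=> t0; exact: superlevel_lty (weak _ t0) Ioo.
(* [F] is a real-valued version of [phi], faithful for [t > 0]; the set [G] below keeps only such
   [t]. *)
pose F (t : R) : R := fine (phi t).
have phiE (t : R) : 0 < t -> phi t = (F t)%:E.
  by move=> t0; rewrite fineK// ge0_fin_numE ?measure_ge0// phioo.
have F0 (t : R) : 0 <= F t by rewrite fine_ge0// measure_ge0.
have mF : measurable_fun setT F.
  by apply: measurableT_comp mphi; exact: fine_measurable.
pose h (t : R) : R := t `^ (q - 1) * F t `^ r.
have h0 (t : R) : 0 <= h t by rewrite mulr_ge0 ?powR_ge0.
have mh : measurable_fun setT h.
  apply: measurable_funM; first exact: measurable_powR.
  exact: measurableT_comp (measurable_powR _) mF.
pose G : set (measurableTypeR R * T) :=
  [set x | 0 < x.1] `&` [set x | x.1 <= `|f x.2|] `&` [set x | g0 x.2 * F x.1 < 2 * a].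
have mG : measurable G.
  apply: measurableI; first apply: measurableI.
  - by apply: measurable_set_ltr; [exact: measurable_cst|exact: measurable_fst].
  - apply: measurable_set_ler; first exact: measurable_fst.
    exact: (measurableT_comp mnf measurable_snd).
  - apply: measurable_set_ltr; last exact: measurable_cst.
    apply: measurable_funM; first exact: (measurableT_comp mg0 measurable_snd).
    exact: (measurableT_comp mF measurable_fst).
pose K (x : measurableTypeR R * T) := (h x.1 * \1_G x)%:E.
have K0 x : (0 <= K x)%E by rewrite lee_fin mulr_ge0.
have mK : measurable_fun setT K.
  apply/measurable_EFinP; apply: measurable_funM.
    exact: (measurableT_comp mh measurable_fst).
  exact: measurable_indic.
have intK t : (\int[mu]_z K (t, z) = (h t)%:E * mu (xsection G t))%E.
  transitivity (\int[mu]_z ((h t)%:E * (\1_(xsection G t) z)%:E))%E.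
    apply: eq_integral => z _; rewrite /K/= -EFinM !indicE; congr (_ * _)%:E.
    by congr (_%:R); congr nat_of_bool; apply/idP/idP; rewrite inE => xG;
      rewrite inE; move: xG; rewrite xsectionE.
  rewrite ge0_integralZl_EFin//.
  - by rewrite integral_indic ?setIT//; exact: measurable_xsection.
  - apply/measurable_EFinP/measurable_indic; exact: measurable_xsection.
have step1 (t : R) : 0 < t ->
    ((t `^ q)%:E * phi t `^ (q / p) * (t^-1)%:E <= 2%:E * \int[mu]_z K (t, z))%E.
  move=> t0.
  (* The part of the superlevel set outside the section of [G] lies in {g0 >= 2a / F t}, whose
     measure is at most [F t / 2] by the weak bound. *)
  have half : (phi t <= 2%:E * mu (xsection G t))%E.
    have [Ft0|Ft0] := eqVneq (F t) 0.
      by rewrite phiE// Ft0 mule_ge0.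
    have Ft : 0 < F t by rewrite lt_def Ft0 F0.
    have mX : measurable (xsection G t) by exact: measurable_xsection.
    have m0 : measurable [set z | 2 * a / F t <= g0 z].
      by apply: measurable_set_ler => //; exact: measurable_cst.
    have : (phi t <= mu (xsection G t) + (F t / 2)%:E)%E.
      apply: (@le_trans _ _ (mu (xsection G t `|` [set z | 2 * a / F t <= g0 z]))).
        apply: le_measure; rewrite ?inE//; first exact: measurableU.
        move=> z /= tz.
        have [|gz] := leP (2 * a / F t) (g0 z); [by right|left].
        rewrite xsectionE /G/=; split; [split=> //|].
        by rewrite -ltr_pdivlMr.
      apply: (le_trans (measureU2 mu mX m0)); rewrite leeD2l//.
      apply: (le_trans (weak _ _)); first by rewrite divr_gt0 ?mulr_gt0.
      by rewrite lee_fin le_eqVlt; apply/orP; left; apply/eqP; field; rewrite !gt_eqF.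
    rewrite phiE//.
    case: (mu (xsection G t)) (measure_ge0 mu (xsection G t)) => [m| |]//.
      by rewrite -EFinM -EFinD !lee_fin => m0' ?; lra.
    by rewrite gt0_muley ?leey ?lte_fin.
  rewrite intK phiE// poweR_EFin qpE powRD; last first.
    by apply/implyP => /eqP e; have := addr_gt0 ltr01 r_gt0; rewrite /r e ltxx.
  rewrite powRr1// -/r.
  have -> : ((t `^ q)%:E * (F t * F t `^ r)%:E * t^-1%:E = (h t)%:E * phi t)%E.
    rewrite phiE// -!EFinM /h -(mulr_powRB1 (ltW t0) q_gt0); congr EFin.
    by field; rewrite gt_eqF.
  by rewrite muleCA; apply: lee_wpmul2l => //; rewrite lee_fin.
(* For fixed [z], [G] confines [t] to (0, |f z|] and forces [F t < 2a / g0 z], so the integral is at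
   most |f z|^q (2a / g0 z)^r. In |f z|^q the factor [g1 z] has exponent [theta * q = p1], and
   [g0 z] has exponent [r], which cancels. *)
have step3 z : (\int[@lebesgue_measure R]_t K (t, z) <=
    ((2 * a) `^ r * g1 z `^ p1)%:E)%E.
  have [fz0|fz0] := eqVneq `|f z| 0.
    rewrite integral0_eq; first by rewrite lee_fin mulr_ge0 ?powR_ge0.
    move=> t _; rewrite /K indicE memNset ?mulr0// => -[[/= t0 tf] _].
    by move: (lt_le_trans t0 tf); rewrite fz0 ltxx.
  have f_gt0 : 0 < `|f z| by rewrite lt_def fz0 normr_ge0.
  have g0_gt0 : 0 < g0 z.
    rewrite lt_def g0_ge0 andbT; apply: contra_neq fz0 => gz.
    by rewrite fE gz powR0 ?mulr0// gt_eqF.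
  pose M := `|f z| `^ (q - 1) * (2 * a / g0 z) `^ r.
  pose D : set R := `]0, `|f z|]%classic.
  have M0 : 0 <= M by rewrite mulr_ge0 ?powR_ge0.
  apply: (@le_trans _ _ (\int[@lebesgue_measure R]_t
      (M%:E * (\1_D t)%:E))%E).
    apply: ge0_le_integral => //.
    - exact: (measurable_fun_pair1 z mK).
    - apply: measurable_funeM; apply/measurable_EFinP/measurable_indic.
      exact: measurable_itv.
    - move=> t _; rewrite /K -EFinM lee_fin /= !indicE.
      have [Gt|Gt] := boolP ((t, z) \in G); last by rewrite mulr0 mulr_ge0.
      move: Gt; rewrite inE => -[[/= t0 tf] gF].
      rewrite mem_set ?mulr1; last by rewrite /D/= in_itv/= t0.
      apply: ler_pM; rewrite ?powR_ge0// ge0_ler_powR// ?nnegrE ?subr_ge0;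
        rewrite ?(ltW t0) ?(ltW q_gt1) ?(ltW r_gt0)//.
      + by rewrite divr_ge0 ?mulr_ge0// ltW.
      + by rewrite ler_pdivlMr// mulrC ltW.
  have mD : measurable D by exact: measurable_itv.
  rewrite ge0_integralZl_EFin//; last by apply/measurable_EFinP/measurable_indic.
  have DE : lebesgue_measure D = (`|f z|)%:E.
    by rewrite /D lebesgue_measure_itv/= lte_fin f_gt0 -EFinB subr0.
  rewrite integral_indic// setIT [X in (_ * X)%E]DE.
  rewrite -EFinM lee_fin /M mulrAC [X in X * _]mulrC (mulr_powRB1 (ltW f_gt0) q_gt0).
  rewrite fE powRM ?powR_ge0// -!powRrM.
  have -> : theta * q = p1 by rewrite /q mulrC divfK ?gt_eqF.
  rewrite [(1 - theta) * q]mulrC -/r powRM ?invr_ge0 ?mulr_ge0 ?(ltW a0)//.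
  rewrite -(powR_inv1 (g0_ge0 z)) -powRrM mulN1r powRN.
  rewrite le_eqVlt; apply/orP; left; apply/eqP; field.
  by rewrite gt_eqF// powR_gt0.
have I0 : (0 <= \int[mu]_z (g1 z `^ p1)%:E)%E.
  by apply: integral_ge0 => z _; rewrite lee_fin powR_ge0.
pose J t := ((t `^ q)%:E * phi t `^ (q / p) * (t^-1)%:E)%E.
have J0 t : 0 < t -> (0 <= J t)%E.
  by move=> t0; rewrite !mule_ge0 ?poweR_ge0// lee_fin ?powR_ge0 ?invr_ge0 ?ltW.
have mintK : measurable_fun setT (fun t => \int[mu]_z K (t, z))%E.
  exact: measurable_fun_fubini_tonelli_F.
have intK0 t : (0 <= \int[mu]_z K (t, z))%E by apply: integral_ge0.
have mD : measurable (`]0%R, +oo[%classic : set R) by exact: measurable_itv.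
have le_lorentz : (\int[@lebesgue_measure R]_(t in `]0%R, +oo[) J t <=
    (2 * (2 * a) `^ r)%:E * \int[mu]_z (g1 z `^ p1)%:E)%E.
  apply: (@le_trans _ _ (\int[@lebesgue_measure R]_(t in `]0%R, +oo[)
      (2%:E * \int[mu]_z K (t, z)))%E).
    apply: ge0_le_integral => //.
    - by move=> t /=; rewrite in_itv/= andbT; exact: J0.
    - apply: emeasurable_funM.
        apply: emeasurable_funM.
          by apply/measurable_EFinP; apply: measurable_funTS; exact: measurable_powR.
        apply: measurable_funTS.
        exact: measurableT_comp (measurable_poweR _) mphi.
      apply/measurable_EFinP.
      apply: (@eq_measurable_fun _ _ _ _ _ (fun t : R => t `^ (-1))).
        by move=> t; rewrite inE/= in_itv/= andbT => t0; rewrite powR_inv1// ltW.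
      by apply: measurable_funTS; exact: measurable_powR.
    - apply: measurable_funeM; exact: measurable_funTS.
    - by move=> t /=; rewrite in_itv/= andbT; exact: step1.
  rewrite ge0_integralZl_EFin//; last exact: measurable_funTS.
  rewrite EFinM -muleA lee_pmul2l ?lte_fin//.
  apply: (@le_trans _ _ (\int[@lebesgue_measure R]_t \int[mu]_z K (t, z))%E).
    exact: ge0_subset_integral.
  rewrite fubini_tonelli// -ge0_integralZl_EFin ?powR_ge0//; last 2 first.
  - by move=> z _; rewrite lee_fin powR_ge0.
  - by apply/measurable_EFinP; exact: measurableT_comp (measurable_powR _) mg1.
  apply: ge0_le_integral => //.
  - by move=> z _; apply: integral_ge0.
  - exact: measurable_fun_fubini_tonelli_G.
  - apply: measurable_funeM; apply/measurable_EFinP.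
    exact: measurableT_comp (measurable_powR _) mg1.
rewrite /lorentz_norm gt0_ler_poweR ?invr_ge0 ?(ltW q_gt0)//.
- rewrite in_itv/= leey andbT mule_ge0 ?lee_fin ?(ltW p_gt0)//.
  by apply: integral_ge0 => t; rewrite /= in_itv/= andbT; exact: J0.
- by rewrite in_itv/= leey andbT mule_ge0// lee_fin !mulr_ge0 ?powR_ge0 ?ltW.
- have -> : 2 * p * (2 * a) `^ r = p * (2 * (2 * a) `^ r) by ring.
  rewrite (EFinM p) -(muleA p%:E); apply: lee_wpmul2l le_lorentz.
  by rewrite lee_fin ltW.
Qed.

(** Removes the finiteness assumptions of [lorentz_hoelder_fin]. The zero cases come first, since 0
    times +oo is 0: if one factor is null, so is [f]. With both factors nonzero, an infinite one
    makes the right-hand side infinite. *)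
Lemma lorentz_hoelder (A : \bar R) : (0 <= A)%E ->
  (forall t, 0 < t -> (mu [set z | t <= g0 z]%R <= t^-1%:E * A)%E) ->
  (lorentz_norm mu p q f <=
   ((2 * p) `^ q^-1 * 2 `^ (1 - theta))%:E *
   ((\int[mu]_z (g1 z `^ p1)%:E) `^ p1^-1) `^ theta * A `^ (1 - theta))%E.
Proof.
move=> A0 weak.
have C0 : 0 < (2 * p) `^ q^-1 * 2 `^ (1 - theta) by rewrite mulr_gt0 ?powR_gt0 ?mulr_gt0.
have fnull (g : T -> R) : measurable_fun setT g ->
    (forall z, g z = 0 -> f z = 0) -> (forall z, 0 <= g z) ->
    (forall t, 0 < t -> mu [set z | t <= g z] = 0%E) -> lorentz_norm mu p q f = 0%E.
  move=> mg gf g0' gnull; apply: lorentz_norm_eq0; rewrite ?gt_eqF// => t t0.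
  apply/eqP; rewrite eq_le measure_ge0 andbT -(null_support mg gnull).
  apply: le_measure; rewrite ?inE//.
    by apply: measurable_set_ltr => //; exact: measurable_cst.
  move=> z /= tz; rewrite lt_neqAle g0' andbT eq_sym; apply/eqP => gz.
  by move: tz; rewrite gf// normr0 leNgt t0.
have I0 : (0 <= \int[mu]_z (g1 z `^ p1)%:E)%E.
  by apply: integral_ge0 => z _; rewrite lee_fin powR_ge0.
have rhs0 : (0 <= ((2 * p) `^ q^-1 * 2 `^ (1 - theta))%:E *
   ((\int[mu]_z (g1 z `^ p1)%:E) `^ p1^-1) `^ theta * A `^ (1 - theta))%E.
  by rewrite !mule_ge0 ?poweR_ge0// lee_fin ltW.
have [A00|A00] := eqVneq A 0%E.
  rewrite (fnull g0)// => [z gz|t t0].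
    by apply/normr0_eq0; rewrite fE gz powR0 ?mulr0// gt_eqF.
  by apply/eqP; rewrite eq_le measure_ge0 andbT (le_trans (weak _ t0))// A00 mule0.
have [I00|I00] := eqVneq (\int[mu]_z (g1 z `^ p1)%:E)%E 0%E.
  rewrite (fnull g1)// => [z gz|t t0].
    by apply/normr0_eq0; rewrite fE gz powR0 ?mul0r// gt_eqF.
  have := chebyshev_powR mu mg1 (ltW p1_gt0) t0; rewrite I00 => le0.
  apply/eqP; rewrite eq_le measure_ge0 andbT.
  by rewrite -(@lee_pmul2l _ (t `^ p1)%:E)// ?mule0// lte_fin powR_gt0.
have A_gt0 : (0 < A)%E by rewrite lt_def A00.
have I_gt0 : (0 < \int[mu]_z (g1 z `^ p1)%:E)%E by rewrite lt_def I00.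
have [Ioo|Ioo] := eqVneq (\int[mu]_z (g1 z `^ p1)%:E)%E +oo%E.
  rewrite Ioo !poweRyr ?invr_neq0 ?gt_eqF// gt0_muley ?lte_fin// gt0_mulye ?leey//.
  exact: poweR_gt0.
have [Aoo|Aoo] := eqVneq A +oo%E.
  by rewrite Aoo poweRyr ?gt_eqF// gt0_muley ?leey// mule_gt0 ?lte_fin// !poweR_gt0.
have Ilt : (\int[mu]_z (g1 z `^ p1)%:E < +oo)%E by rewrite ltey.
move: A_gt0 Aoo weak => /[swap].
case: A A0 A00 rhs0 => [a| |]// _ _ _ _; rewrite lte_fin => a0 weak.
apply: (le_trans (lorentz_hoelder_fin a0 _ Ilt)).
  by move=> t t0; rewrite (le_trans (weak _ t0))// -EFinM mulrC.
have [v vE] : exists v, (\int[mu]_z (g1 z `^ p1)%:E)%E = v%:E.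
  by exists (fine (\int[mu]_z (g1 z `^ p1)%:E)); rewrite fineK// ge0_fin_numE.
rewrite vE -EFinM !poweR_EFin -!EFinM lee_fin.
have v0 : 0 <= v by rewrite -lee_fin -vE.
have p2 : 0 <= 2 * p by rewrite mulr_ge0 ?ltW.
rewrite (powRM _ (mulr_ge0 p2 (powR_ge0 _ _)) v0) (powRM _ p2 (powR_ge0 _ _)).
(* Under the q-th root the exponent [r] becomes [1 - theta], and the integral of g1^p1 gets the
   exponent 1/q = theta/p1. *)
have qK : q * (1 - theta) * q^-1 = 1 - theta by rewrite mulrAC mulfV ?gt_eqF// mul1r.
rewrite -[(2 * a) `^ _ `^ _]powRrM qK.
rewrite (powRM _ _ (ltW a0))//.
rewrite -[v `^ _ `^ _]powRrM (_ : p1^-1 * theta = q^-1) ?invf_div 1?mulrC//.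
by rewrite le_eqVlt; apply/orP; left; apply/eqP; ring.
Qed.

End lorentz_hoelder.

(** * Summing local bounds over a countable cover *)

Section countable_covers.
Context d1 d2 (T1 : measurableType d1) (T2 : measurableType d2) (R : realType).
Variables (mu : {measure set T1 -> \bar R}) (nu : {measure set T2 -> \bar R}).

(** The sets [box j] may overlap, which subadditivity tolerates; the sets [Q j] are disjoint, so
    that their integrals add up to at most the full integral. *)
Lemma le_measure_disjoint_cover (J : countType) (P : set J) (B : set T1)
    (box : J -> set T1) (Q : J -> set T2) (g : T2 -> \bar R) (K : R) :
  0 <= K -> measurable B -> (forall j, measurable (box j)) ->
  (forall j, measurable (Q j)) ->
  measurable_fun setT g -> (forall x, 0 <= g x)%E ->
  (forall j, P j -> (mu (box j) <= K%:E * \int[nu]_(x in Q j) g x)%E) ->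
  trivIset P Q -> B `<=` \bigcup_(j in P) box j ->
  (mu B <= K%:E * \int[nu]_x g x)%E.
Proof.
move=> K0 mB mbox mQ mg g0 muK tQ cover.
(* Families over [J] become sequences through the numbering of [J]; numbers that encode no element
   of [P] receive the empty set. *)
pose pick (U : Type) (F : J -> set U) t : set U :=
  if pickle_inv t is Some j then (if `[< P j >] then F j else set0) else set0.
have mpick1 t : measurable (pick _ box t).
  by rewrite /pick; case: pickle_inv => // j; case: asboolP.
have mpick2 t : measurable (pick _ Q t).
  by rewrite /pick; case: pickle_inv => // j; case: asboolP.
apply: (@le_trans _ _ (mu (\bigcup_t pick _ box t))).
  apply: le_measure; rewrite ?inE//; first exact: bigcupT_measurable.
  move=> x /cover [j Pj bx]; exists (pickle j) => //.
  by rewrite /pick pickleK_inv; case: asboolP.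
apply: (le_trans (generalized_Boole_inequality _ _ _)) => //.
  exact: bigcupT_measurable.
apply: (@le_trans _ _ (\sum_(t <oo) K%:E * \int[nu]_(x in pick _ Q t) g x)%E).
  apply: lee_nneseries => [t _ _|t _]; first exact: measure_ge0.
  rewrite /pick; case: pickle_inv => [j|]; last by rewrite measure0 integral_set0 mule0.
  by case: asboolP => [Pj|_]; [exact: muK|rewrite measure0 integral_set0 mule0].
rewrite nneseriesZl; last by move=> t _; exact: integral_ge0.
apply: lee_wpmul2l => //.
rewrite -ge0_integral_bigcup//.
- apply: ge0_subset_integral => //; exact: bigcupT_measurable.
- exact: measurable_funTS.
- apply/trivIsetP => s t _ _ st; rewrite /pick.
  case Es: (pickle_inv s) => [i|]; last by rewrite set0I.
  case Et: (pickle_inv t) => [j|]; last by rewrite setI0.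
  case: asboolP => Pi; last by rewrite set0I.
  case: asboolP => Pj; last by rewrite setI0.
  move/trivIsetP: tQ; apply => //; apply: contra_neq st => ij.
  have := @pickle_invK J s; have := @pickle_invK J t.
  by rewrite Es Et /= ij => -> ->.
Qed.

End countable_covers.

(** * Dyadic cells on the line and maximal heavy cells *)

Section dyadic_cells.
Variables (R : realType) (L : R).
Hypothesis L_gt0 : 0 < L.

Definition dyadic_len (m : nat) : R := L / 2 ^+ m.

(** As fibres of a floor function, the cells of one generation are disjoint at once, and nestedness
    reduces to [floor_div_pow2]. *)
Definition dyadic_cell (m : nat) (k : int) : set R :=
  [set z | Num.floor (z / dyadic_len m) = k].

Local Notation len := dyadic_len.
Local Notation cell := dyadic_cell.

Lemma dyadic_len_gt0 m : 0 < len m.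
Proof. by rewrite /dyadic_len divr_gt0// exprn_gt0. Qed.

Lemma dyadic_cellE m k :
  cell m k = `[k%:~R * len m, (k%:~R + 1) * len m[%classic.
Proof.
apply/seteqP; split => z; rewrite /dyadic_cell/= in_itv/=.
  move=> /eqP; rewrite floor_eq ler_pdivlMr ?dyadic_len_gt0//.
  by rewrite ltr_pdivrMr ?dyadic_len_gt0// intrD.
move=> zk; apply/eqP; rewrite floor_eq ler_pdivlMr ?dyadic_len_gt0//.
by rewrite ltr_pdivrMr ?dyadic_len_gt0// intrD.
Qed.

Lemma measurable_dyadic_cell m k : measurable (cell m k : set (measurableTypeR R)).
Proof. by rewrite dyadic_cellE; exact: measurable_itv. Qed.

(** The floor of y / 2^d is found by comparing [y] with integers K 2^d, and such comparisons depend
    only on the floor of [y]. *)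
Lemma floor_div_pow2 (d : nat) (x y : R) : Num.floor x = Num.floor y ->
  Num.floor (x / 2 ^+ d) = Num.floor (y / 2 ^+ d).
Proof.
move=> xy; apply/eqP; rewrite floor_eq.
have p0 : 0 < 2 ^+ d :> R by rewrite exprn_gt0.
set K := Num.floor (y / _).
have pE (z : int) : z%:~R * 2 ^+ d = (z * 2 ^+ d)%:~R :> R by rewrite intrM rmorphXn.
have K1 : K%:~R * 2 ^+ d <= y by rewrite -ler_pdivlMr// floor_le.
have K2 : y < (K + 1)%:~R * 2 ^+ d by rewrite -ltr_pdivrMr// floorD1_gt.
rewrite ler_pdivlMr// ltr_pdivrMr//; apply/andP; split.
  by rewrite pE -floor_ge_int xy floor_ge_int -pE.
by rewrite pE ltNge -floor_ge_int xy floor_ge_int -ltNge -pE.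
Qed.

Lemma dyadic_len_le m m' : (m' <= m)%N -> len m <= len m'.
Proof.
move=> mm; rewrite /dyadic_len ler_pM2l// lef_pV2 ?posrE ?exprn_gt0//.
by rewrite ler_weXn2l// ler1n.
Qed.

Lemma dyadic_cell_nested m m' k k' : (m' <= m)%N ->
  cell m k `&` cell m' k' !=set0 -> cell m k `<=` cell m' k'.
Proof.
move=> mm [z [/= zk zk']] y /= yk.
have E x : x / len m' = (x / len m) / 2 ^+ (m - m').
  rewrite /dyadic_len -{1}(subnK mm) exprD; field.
  by rewrite ?gt_eqF ?expf_neq0.
by rewrite /dyadic_cell/= -zk' !E; apply: floor_div_pow2; rewrite yk zk.
Qed.

(** Take the first generation of length at most [r]. It is not generation 0 because [r < L], so the
    preceding one has length above [r]. *)
Lemma dyadic_scale (r : R) : 0 < r -> r < L -> exists m, len m <= r < 2 * len m.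
Proof.
move=> r0 rL.
have ex : exists m, len m <= r.
  (* This number exceeds L / r, and 2^m > m. *)
  exists (Num.truncn (L / r)).+1; rewrite /dyadic_len.
  rewrite ler_pdivrMr ?exprn_gt0// mulrC -ler_pdivrMr//.
  apply: (le_trans (ltW (truncnS_gt _))).
  by rewrite -natrX ler_nat ltnW// ltn_expl.
case: (ex_minnP ex) => m mr mmin; exists m; rewrite mr/=.
case: m mr mmin => [|m] mr mmin.
  by move: rL; rewrite ltNge -[L]divr1 -(expr0 (2 : R)) mr.
rewrite ltNge; apply/negP => le2; have := mmin m.
rewrite (le_trans _ le2) ?ltnn; first by move=> /(_ isT).
by rewrite /dyadic_len exprS le_eqVlt; apply/orP; left; apply/eqP; field;
  rewrite expf_neq0.
Qed.

(* Maximal among the heavy cells of length at most L. *)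
Definition maximal_cell (heavy : nat -> int -> Prop) (j : nat * int) : Prop :=
  heavy j.1 j.2 /\ forall m k, (m < j.1)%N -> heavy m k ->
    cell j.1 j.2 `&` cell m k = set0.

(** For cells of different generations, the maximality of the finer one excludes that the coarser
    one meets it. *)
Lemma maximal_cell_trivIset heavy :
  trivIset (maximal_cell heavy) (fun j => cell j.1 j.2).
Proof.
move=> [m k] [m' k'] [/= hk mk] [/= hk' mk'] /set0P ne.
have [mm|mm|mm] := ltngtP m m'.
- by move: ne; rewrite setIC (mk' _ _ mm hk) eqxx.
- by move: ne; rewrite (mk _ _ mm hk') eqxx.
- by move: ne => /set0P [z []]; rewrite /dyadic_cell/= mm => <- <-.
Qed.

(** Take the coarsest heavy cell containing the given one. A still coarser heavy cell meeting it
    would contain it by nestedness, hence contain the given cell too. *)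
Lemma maximal_cell_exists heavy m k : heavy m k -> exists j,
  [/\ maximal_cell heavy j, (j.1 <= m)%N & cell m k `<=` cell j.1 j.2].
Proof.
move=> hk.
pose Pr m' := `[< exists k', heavy m' k' /\ cell m k `<=` cell m' k' >].
have ex : exists m', Pr m' by exists m; apply/asboolP; exists k; split.
case: (ex_minnP ex) => m' /asboolP[k' [hk' sub]] mmin.
have mm : (m' <= m)%N by apply: mmin; apply/asboolP; exists k; split.
exists (m', k'); split => //; split => //= m2 k2 m2m' h2.
apply/eqP/negPn/negP => /set0P ne.
have : (m' <= m2)%N.
  apply: mmin; apply/asboolP; exists k2; split => //.
  by apply: (subset_trans sub); apply: dyadic_cell_nested ne; exact: ltnW.
by rewrite leqNgt m2m'.
Qed.

End dyadic_cells.

(** * The covering estimate for the pairs attached to one line *)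

Section line_covering.
Variables (R : realType) (n : nat) (i : 'I_n.+1) (w : 'rV[R]_n).
Variables (g : R -> R) (c : R).
Hypotheses (c_gt0 : 0 < c) (g_ge0 : forall t, 0 <= g t)
  (mg : measurable_fun setT g).

Local Notation leb := (@lebesgue_measure R).

Let mEg : measurable_fun setT (fun t => (g t)%:E).
Proof. exact/measurable_EFinP. Qed.

Let Eg_ge0 x : (0 <= (g x)%:E)%E.
Proof. by rewrite lee_fin. Qed.

Let side (x y : R) : set (measurableTypeR R) := `[x, y]%classic.

(** The pairs close to the dyadic cell of length [l] with left end [a]. All [n.+2] sides have length
    [6 * l]. *)
Let cube (l : R) (a : R) : set (measurableTypeR R * 'rV[R]_n.+1) :=
  side (a - 2 * l) (a + 4 * l) `*` rV_box (fun j =>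
    if unlift i j is Some k then side (w ord0 k - 3 * l) (w ord0 k + 3 * l)
    else side (a - 2 * l) (a + 4 * l)).

Let measurable_cube l a : measurable (cube l a).
Proof.
apply: measurableX; first exact: measurable_itv.
by apply: measurable_rV_box => j; case: unlift => [k|]; exact: measurable_itv.
Qed.

Let cubeE l a : 0 < l ->
  (leb \x lebesgue_rV R n.+1)%E (cube l a) = ((6 * l) ^+ n.+2)%:E.
Proof.
move=> l0.
have sideE x y : y - x = 6 * l -> leb (side x y) = (6 * l)%:E.
  move=> xy; rewrite /side lebesgue_measure_itv/= lte_fin -subr_gt0 xy.
  by rewrite mulr_gt0// -EFinB xy.
have mside j : measurable (if unlift i j is Some k
    then side (w ord0 k - 3 * l) (w ord0 k + 3 * l)
    else side (a - 2 * l) (a + 4 * l)).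
  by case: unlift => [k|]; exact: measurable_itv.
rewrite /cube product_measure1E//; [|exact: measurable_itv|exact: measurable_rV_box].
transitivity ((6 * l)%:E * \prod_(j < n.+1) (6 * l)%:E)%E.
  congr (_ * _)%E; first by apply: sideE; ring.
  rewrite lebesgue_rV_boxE//; apply: eq_bigr => j _.
  by case: unlift => [k|]; apply: sideE; ring.
by rewrite prodEFin -EFinM prodr_const card_ord -exprS.
Qed.

(* The interval between a and v_i meets at most three cells of length about r,
   and one of them is heavy: it carries a third of the mass required. *)
Lemma line_covering (B : set (measurableTypeR R * 'rV[R]_n.+1)) :
  measurable B ->
  (forall a v, B (a, v) -> exists2 r : R, 0 < r &
    [/\ ((c * r ^+ n.+2)%:E <=
         \int[leb]_(t in `[Num.min a (v ord0 i), Num.max a (v ord0 i)]) (g t)%:E)%E,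
        `|a - v ord0 i| <= r &
        forall k, `|v ord0 (lift i k) - w ord0 k| <= r]) ->
  ((leb \x lebesgue_rV R n.+1)%E B <=
    (3 * 6 ^+ n.+2 / c)%:E * \int[leb]_t (g t)%:E)%E.
Proof.
move=> mB HB.
have C0 : 0 < 3 * 6 ^+ n.+2 / c by rewrite divr_gt0// mulr_gt0// exprn_gt0.
have [Ioo|Ioo] := eqVneq (\int[leb]_t (g t)%:E)%E +oo%E.
  by rewrite Ioo gt0_muley ?leey// lte_fin.
have I0 : (0 <= \int[leb]_t (g t)%:E)%E by exact: integral_ge0.
have [I IE] : exists I, (\int[leb]_t (g t)%:E)%E = I%:E.
  by exists (fine (\int[leb]_t (g t)%:E)); rewrite fineK// ge0_fin_numE// ltey.
have I_ge0 : 0 <= I by rewrite -lee_fin -IE.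
(* An upper bound for all admissible [r]: if [r >= L], then [r >= 1] and r^(n+2) >= r >= L > I/c,
   against the mass available. So cells longer than [L] can be ignored. *)
pose L := 1 + I / c.
have L1 : 1 <= L by rewrite /L lerDl divr_ge0// ltW.
have L0 : 0 < L by exact: lt_le_trans L1.
have rL (r : R) : 0 < r -> ((c * r ^+ n.+2)%:E <= I%:E)%E -> r < L.
  move=> r0; rewrite lee_fin mulrC -ler_pdivlMr// => rI.
  rewrite ltNge; apply/negP => Lr.
  have : L <= r ^+ n.+2.
    apply: (le_trans Lr); rewrite -{1}(expr1 r) ler_weXn2l//.
    exact: le_trans L1 Lr.
  by rewrite leNgt /L (le_lt_trans rI)// ltrDr.
pose nu (A : set (measurableTypeR R)) := (\int[leb]_(t in A) (g t)%:E)%E.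
pose heavy (m : nat) (k : int) : Prop :=
  ((c * dyadic_len L m ^+ n.+2)%:E <= 3%:E * nu (dyadic_cell L m k))%E.
apply: (@le_measure_disjoint_cover _ _ _ _ _
    (product_sf leb (lebesgue_rV R n.+1)) leb _ (maximal_cell L heavy) B
    (fun j => cube (dyadic_len L j.1) (j.2%:~R * dyadic_len L j.1))
    (fun j => dyadic_cell L j.1 j.2) (fun t => (g t)%:E)) => //.
- exact: ltW.
- by move=> j; exact: (measurable_dyadic_cell L0).
(* The cube has measure (6l)^(n+2), that is 6^(n+2)/c times c l^(n+2), and heaviness bounds the
   latter by three times the mass of the cell. *)
- move=> [m k] [/= hk _]; rewrite [X in (X <= _)%E] (cubeE _ (dyadic_len_gt0 L0 m))//.
  rewrite exprMn (_ : 6 ^+ _ * _ = (6 ^+ n.+2 / c) * (c * dyadic_len L m ^+ n.+2)).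
    rewrite EFinM (_ : 3 * _ / _ = 6 ^+ n.+2 / c * 3); last by rewrite -mulrA mulrC.
    rewrite (EFinM _ 3) -muleA lee_wpmul2l// lee_fin ltW//.
    by rewrite divr_gt0// exprn_gt0.
  by rewrite [RHS]mulrA divfK ?gt_eqF.
- exact: maximal_cell_trivIset.
- move=> [a v] /HB[r r0 [rint avr vwr]].
  set x : R := Num.min a (v ord0 i) in rint *; set y : R := Num.max a (v ord0 i) in rint *.
  have mcell m k := measurable_dyadic_cell L0 m k.
  have r_lt_L : r < L.
    apply: rL => //; rewrite -IE; apply: (le_trans rint).
    by apply: ge0_subset_integral.
  have [m /andP[lr rl]] := dyadic_scale r0 r_lt_L.
  pose l := dyadic_len L m.
  have l0 : 0 < l by exact: dyadic_len_gt0.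
  pose k := Num.floor (x / l).
  have kx : k%:~R * l <= x by rewrite -ler_pdivlMr// floor_le.
  have xk : x < (k%:~R + 1) * l.
    by rewrite -ltr_pdivrMr// -[1]/(1%:~R) -intrD floorD1_gt.
  have yx : y - x <= r.
    move: avr; rewrite /x /y /Num.min /Num.max; case: (ltP a) => av.
      by rewrite ltr0_norm ?subr_lt0// opprB.
    by rewrite ger0_norm ?subr_ge0.
  have yk : y < (k%:~R + 3) * l by rewrite -/l in rl; nra.
  have cover3 : `[x, y]%classic `<=` dyadic_cell L m k `|`
      (dyadic_cell L m (k + 1) `|` dyadic_cell L m (k + 2)).
    move=> t /=; rewrite in_itv/= => /andP[xt ty].
    rewrite !dyadic_cellE//= !in_itv/= -/l !intrD.
    rewrite mulr1z addrA.
    have [t1|t1] := ltP t ((k%:~R + 1) * l); [left|right].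
      by rewrite (le_trans kx).
    have [t2|t2] := ltP t ((k%:~R + 1 + 1) * l); [left|right] => //=.
    by rewrite (le_lt_trans ty)// (lt_le_trans yk)// ler_pM2r//; lra.
  (* Pigeonhole: the three cells together carry mass at least c r^(n+2) >= c l^(n+2), so one of them
     carries a third of c l^(n+2). *)
  have [e [e0 e2 he]] : exists e : int, [/\ 0 <= e, e <= 2 & heavy m (k + e)].
    have nuE j : exists2 s, nu (dyadic_cell L m j) = s%:E & 0 <= s.
      have nu0 : (0 <= nu (dyadic_cell L m j))%E by exact: integral_ge0.
      exists (fine (nu (dyadic_cell L m j))); last exact: fine_ge0.
      rewrite fineK// ge0_fin_numE//; apply: (@le_lt_trans _ _ I%:E); last exact: ltry.
      by rewrite -IE; exact: ge0_subset_integral.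
    have [s0 E0 _] := nuE k; have [s1 E1 _] := nuE (k + 1).
    have [s2 E2 _] := nuE (k + 2).
    have disj j j' : j != j' -> dyadic_cell L m j `&` dyadic_cell L m j' = set0.
      move=> jj; apply/seteqP; split => // t [/= tj tj'].
      by move: jj; rewrite -tj -tj' eqxx.
    have : (c * r ^+ n.+2 <= s0 + (s1 + s2)).
      rewrite -lee_fin; apply: (le_trans rint).
      apply: (@le_trans _ _ (nu (dyadic_cell L m k `|`
          (dyadic_cell L m (k + 1) `|` dyadic_cell L m (k + 2))))).
        apply: ge0_subset_integral => //; first by do !apply: measurableU.
        exact: measurable_funTS.
      rewrite /nu ge0_integral_setU//; last 3 first.
      - exact: measurableU.
      - exact: measurable_funTS.
      - apply/eqP; rewrite setIUr !disj ?setU0//.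
          by rewrite -subr_eq0 opprD addNKr.
        by rewrite -subr_eq0 opprD addNKr.
      rewrite ge0_integral_setU//; last 2 first.
      - exact: measurable_funTS.
      - by apply/eqP; rewrite disj// (inj_eq (addrI _)).
      by rewrite -!/(nu _) E0 E1 E2 -!EFinD.
    have lr' : c * l ^+ n.+2 <= c * r ^+ n.+2.
      by rewrite ler_pM2l// lerXn2r ?nnegrE ?(ltW l0) ?(ltW r0).
    move=> le_s.
    have [h0|h0] := leP (c * l ^+ n.+2) (3 * s0).
      by exists 0; split => //; rewrite addr0 /heavy E0 -EFinM lee_fin.
    have [h1|h1] := leP (c * l ^+ n.+2) (3 * s1).
      by exists 1; split => //; rewrite /heavy E1 -EFinM lee_fin.
    exists 2; split => //; rewrite /heavy E2 -EFinM lee_fin.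
    by rewrite -/l in le_s *; lra.
  have [[m' k'] [maxj /= mm sub]] := maximal_cell_exists L0 he.
  exists (m', k') => //=.
  set l' := dyadic_len L m'.
  have ll' : l <= l' by exact: dyadic_len_le.
  have : dyadic_cell L m' k' ((k + e)%:~R * l).
    by apply: sub; rewrite dyadic_cellE//= in_itv/= lexx ltr_pM2r// ltrDl ltr01.
  rewrite dyadic_cellE//= in_itv/= -/l' intrD => /andP[ke1 ke2].
  have e0R : 0 <= e%:~R :> R by rewrite ler0z.
  have e2R : e%:~R <= 2 :> R by rewrite (ler_int R e 2).
  (* The heavy cell starts at (k+e) l with e at most 2, so [x] lies at most 2l to its left, while y
     < (k+3) l <= (k+e) l + 3l. Since l <= l' and the heavy cell lies in the maximal one, of left
     end k' l', the bounds k' l' - 2l' and k' l' + 4l' follow. *)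
  have xlow : k'%:~R * l' - 2 * l' <= x by nra.
  have yup : y <= k'%:~R * l' + 4 * l' by nra.
  have xa : x <= a <= y by rewrite /x /y ge_min le_max lexx.
  have xv : x <= v ord0 i <= y by rewrite /x /y ge_min le_max lexx !orbT.
  have insd t : x <= t <= y -> side (k'%:~R * l' - 2 * l') (k'%:~R * l' + 4 * l') t.
    move=> /andP[xt ty]; rewrite /side/= in_itv/=.
    by rewrite (le_trans xlow)// (le_trans ty).
  split; first exact: insd.
  move=> j /=; have [j' ->|->] := unliftP i j; rewrite ?liftK ?unlift_none.
    rewrite /side/= in_itv/=; have := vwr j'; rewrite ler_norml => /andP[v1 v2].
    by apply/andP; split; rewrite -/l in rl; lra.
  exact: insd.
Qed.

End line_covering.

(** * Variation of a function along a line parallel to an axis *)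

Section line_variation.
Variables (R : realType) (n : nat) (i : 'I_n.+1) (w : 'rV[R]_n).
Variable u : 'rV[R]_n.+1 -> R.

Local Notation leb := (@lebesgue_measure R).

Lemma rV_insD (h t : R) :
  rV_ins i (h + t) w = h *: delta_mx ord0 i + rV_ins i t w.
Proof.
apply/rowP => j; rewrite !mxE eqxx/=; case: unliftP => [k ->|->].
  by rewrite eq_sym (negbTE (neq_lift _ _)) mulr0 add0r.
by rewrite eqxx mulr1.
Qed.

Lemma continuous_rV_ins : continuous (fun t : R => rV_ins i t w).
Proof.
have -> : (fun t : R => rV_ins i t w) =
    (fun t => t *: delta_mx ord0 i + rV_ins i 0 w).
  by apply/funext => t; rewrite -rV_insD addr0.
move=> t; apply: cvgD; last exact: cvg_cst.
by apply: cvgZr_tmp.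
Qed.

Let phi t := u (rV_ins i t w).

(** Transfers derivability and the derivative from [u] in direction [i] to the one-variable function
    [phi]. *)
Let quotientE t :
  (fun h : R => h^-1 *: ((phi \o shift t) (h *: (1 : R)) - phi t)) =
  (fun h : R => h^-1 *: ((u \o shift (rV_ins i t w)) (h *: delta_mx ord0 i) -
     u (rV_ins i t w))).
Proof.
by apply/funext => h; rewrite /phi /= -rV_insD [h *: 1]mulr1.
Qed.

Hypothesis du : forall x, derivable u x (delta_mx ord0 i).
Hypothesis cdu : continuous (partial i u).

Let derivable_phi t : derivable phi t 1.
Proof. by rewrite /derivable quotientE; exact: du. Qed.

Let derive_phi t : 'D_1 phi t = partial i u (rV_ins i t w).
Proof. by rewrite /partial /derive quotientE. Qed.

Let cdphi : continuous (fun t : R => partial i u (rV_ins i t w)).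
Proof.
move=> t; apply: continuous_comp; [exact: continuous_rV_ins|exact: cdu].
Qed.

Let cphi : continuous phi.
Proof.
by move=> t; apply: differentiable_continuous; apply/derivable1_diffP.
Qed.

(** The fundamental theorem of calculus for [phi], whose derivative is continuous. [Num.min] and
    [Num.max] make the bound symmetric, as either endpoint of an edge may come first. *)
Lemma line_variation_le (a b : R) : ((`|u (rV_ins i b w) - u (rV_ins i a w)|)%:E <=
  \int[leb]_(t in `[Num.min a b, Num.max a b]) (`|partial i u (rV_ins i t w)|)%:E)%E.
Proof.
wlog ab : a b / a < b.
  move=> H; have [ab|ab|->] := ltgtP a b.
  - by have := H _ _ ab; rewrite (min_l (ltW ab)) (max_r (ltW ab)).
  - by have := H _ _ ab; rewrite (min_l (ltW ab)) (max_r (ltW ab)) distrC.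
  - by rewrite subrr normr0 integral_ge0// => t _; rewrite lee_fin.
rewrite (min_l (ltW ab)) (max_r (ltW ab)).
have FTC : (\int[leb]_(t in `[a, b]) (partial i u (rV_ins i t w))%:E =
    (phi b)%:E - (phi a)%:E)%E.
  apply: (@continuous_FTC2 _ (fun t => partial i u (rV_ins i t w)) phi _ _ ab).
  - exact: continuous_subspaceT.
  - split; first by move=> t _.
    + by apply: cvg_at_right_filter; exact: cphi.
    + by apply: cvg_at_left_filter; exact: cphi.
  - by move=> t _; rewrite derive1E derive_phi.
have -> : ((`|u (rV_ins i b w) - u (rV_ins i a w)|)%:E =
    `|\int[leb]_(t in `[a, b]) (partial i u (rV_ins i t w))%:E|)%E.
  by rewrite FTC.
apply: le_abse_integral; first exact: measurable_itv.
apply/measurable_EFinP; apply: measurable_funTS.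
exact: continuous_measurable_fun.
Qed.

End line_variation.

(** * The Euclidean norm and measurability of the difference quotients *)

Section enorm.
Variable R : realType.

Lemma coord_le_enorm m (x : 'rV[R]_m) j : `|x ord0 j| <= enorm x.
Proof.
rewrite /enorm -sqrtr_sqr ler_wsqrtr// (bigD1 j)//= lerDl sumr_ge0// => k _.
exact: sqr_ge0.
Qed.

Lemma enorm_ge0 m (x : 'rV[R]_m) : 0 <= enorm x.
Proof. exact: sqrtr_ge0. Qed.

Lemma measurable_enormB m : measurable_fun setT
  (fun z : 'rV[R]_m * 'rV[R]_m => enorm (z.1 - z.2)).
Proof.
apply: (measurableT_comp (@measurable_enorm R m)).
apply: measurable_fun_rVP => j; under eq_fun do rewrite !mxE.
apply: measurable_funB.
  exact: (measurableT_comp (@measurable_coord R m j) measurable_fst).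
exact: (measurableT_comp (@measurable_coord R m j) measurable_snd).
Qed.

End enorm.

Section quotients.
Variables (R : realType) (m : nat) (u : 'rV[R]_m -> R).

Lemma measurable_diff : measurable_fun setT u ->
  measurable_fun setT (fun z : 'rV[R]_m * 'rV[R]_m => u z.1 - u z.2).
Proof.
move=> mu; apply: measurable_funB.
  exact: (measurableT_comp mu measurable_fst).
exact: (measurableT_comp mu measurable_snd).
Qed.

Lemma measurable_diff_quotient (a : R) : measurable_fun setT u ->
  measurable_fun setT (diff_quotient a u).
Proof.
move=> mu; apply: measurable_funM; first exact: measurable_diff.
under eq_fun do rewrite -powRN.
exact: measurableT_comp (measurable_powR _) (@measurable_enormB _ _).
Qed.

End quotients.

Lemma sume_const_ord (R : realDomainType) (k : nat) (x : \bar R) :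
  (\sum_(i < k) x)%E = (k%:R%:E * x)%E.
Proof.
elim: k => [|k IH]; first by rewrite big_ord0 mul0e.
rewrite big_ord_recr/= IH -natr1 EFinD ge0_muleDl ?mul1e ?lee_fin//.
Qed.

(** * The weak L^1 bound for the quotient of exponent N + 1 *)

Section weak_type.
Variables (R : realType) (n : nat) (u : 'rV[R]_n.+1 -> R).
Hypothesis su : smooth u.

Local Notation N := n.+1.
Local Notation leb := (@lebesgue_measure R).
Local Notation lebN := (lebesgue_rV R n.+1).

Let cu : continuous u. Proof. exact: (su [::]).1. Qed.

Let du i x : derivable u x (delta_mx ord0 i). Proof. exact: (su [::]).2. Qed.

Let cdu i : continuous (partial i u). Proof. exact: (su [:: i]).1. Qed.

Let measurable_u : measurable_fun setT u. Proof. exact: continuous_rV_measurable. Qed.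

Let mdu i : measurable_fun setT (partial i u).
Proof. exact: continuous_rV_measurable. Qed.

(** The pairs whose [i]-th edge carries a large variation; [n.+2] is N + 1. The diagonal is cut out
    because the second inequality holds trivially there. *)
Let axis_step (i : nat) (l : R) : set ('rV[R]_N * 'rV[R]_N) :=
  [set z | 0 < enorm (z.1 - z.2)] `&`
  [set z | l * enorm (z.1 - z.2) ^+ n.+2 <=
    `|u (rV_mix i.+1 z.2 z.1) - u (rV_mix i z.2 z.1)|].

Let measurable_axis_step i l : measurable (axis_step i l).
Proof.
apply: measurableI.
  apply: measurable_set_ltr; [exact: measurable_cst|exact: measurable_enormB].
apply: measurable_set_ler.
  apply: measurable_funM; first exact: measurable_cst.
  exact: measurable_funX (@measurable_enormB _ _).
apply: measurableT_comp => //; apply: measurable_funB.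
  by apply: (measurableT_comp measurable_u); apply: measurable_rV_mix;
    [exact: measurable_snd|exact: measurable_fst].
by apply: (measurableT_comp measurable_u); apply: measurable_rV_mix;
  [exact: measurable_snd|exact: measurable_fst].
Qed.

(** In the coordinates of [rV_path] the section over each [w] concerns a single line. There
    [line_covering] applies with [r] the distance of the two points, and integration over [w]
    restores the integral over R^N. *)
Let axis_step_le (i : 'I_N) l : 0 < l ->
  ((lebN \x lebN) (axis_step i l) <=
   (3 * 6 ^+ n.+2 / l)%:E * \int[lebN]_x (`|partial i u x|)%:E)%E.
Proof.
move=> l0.
have mad : measurable_fun setT (fun x => (`|partial i u x|)%:E).
  by apply/measurable_EFinP; apply: measurableT_comp.
have C0 : 0 <= 3 * 6 ^+ n.+2 / l.
  by rewrite divr_ge0 ?(ltW l0)// mulr_ge0// exprn_ge0.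
have mX := measurable_axis_step i l.
rewrite -(lebesgue_rV_path i mX) -(integral_rV_ins i mad)//.
have mpX : measurable (@rV_path R n i @^-1` axis_step i l).
  by rewrite -[X in measurable X]setTI; exact: measurable_rV_path.
have mI : measurable_fun setT (fun w => \int[leb]_a (`|partial i u (rV_ins i a w)|)%:E)%E.
  apply: (@measurable_fun_fubini_tonelli_F _ _ _ _ _ leb
    (fun t : 'rV[R]_n * measurableTypeR R => (`|partial i u (rV_ins i t.2 t.1)|)%:E)) => //.
  apply: (measurableT_comp mad).
  by apply: measurable_rV_ins; [exact: measurable_snd|exact: measurable_fst].
rewrite -ge0_integralZl_EFin//; last by move=> w _; apply: integral_ge0.
apply: ge0_le_integral => //.
- exact: (measurable_fun_xsection (product_sf leb lebN) mpX).
- exact: measurable_funeM.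
move=> w _ /=; apply: (@line_covering _ _ i w (fun t => `|partial i u (rV_ins i t w)|)) => //.
- apply: measurableT_comp => //; apply: (measurableT_comp (mdu i)).
  by apply: measurable_rV_ins; [exact: measurable_id|exact: measurable_cst].
- exact: measurable_xsection.
move=> a v; rewrite xsectionE => -[/=]; set r := enorm _ => r0.
have E1 : rV_mix i (rV_mix i (rV_ins i a w) v) (rV_mix i v (rV_ins i a w)) = rV_ins i a w.
  by apply/rowP => j; rewrite !mxE; case: (j < i)%N.
have E2 : rV_mix i.+1 (rV_mix i (rV_ins i a w) v) (rV_mix i v (rV_ins i a w)) =
    rV_ins i (v ord0 i) w.
  apply/rowP => j; rewrite !mxE ltnS; case: ltngtP => [ji|ji|/val_inj ->] //.
  - by case: unliftP => // ij; move: ji; rewrite ij ltnn.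
  - by case: unliftP => // ij; move: ji; rewrite ij ltnn.
  - by rewrite unlift_none.
rewrite E1 E2 => step.
have vr j : `|v ord0 j - rV_ins i a w ord0 j| <= r.
  apply: le_trans (coord_le_enorm _ j); rewrite !mxE; case: (j < i)%N => //.
  by rewrite distrC.
exists r => //; split.
- by apply: le_trans (line_variation_le _ _ _ _ _); rewrite ?lee_fin.
- by have := vr i; rewrite rV_ins_eq distrC.
- by move=> k; have := vr (lift i k); rewrite rV_ins_lift.
Qed.

Lemma partial_le_gradient i x : `|partial i u x| <= enorm (gradient u x).
Proof. by have := coord_le_enorm (gradient u x) i; rewrite mxE. Qed.

Lemma measurable_gradient : measurable_fun setT (gradient u).
Proof. by apply: measurable_fun_rVP => j; under eq_fun do rewrite mxE; exact: mdu. Qed.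

Lemma grad_L1E : grad_L1 u = (\int[lebN]_x (enorm (gradient u x))%:E)%E.
Proof.
rewrite /grad_L1 Lnorm1; apply: eq_integral => x _.
by rewrite /= ger0_norm// enorm_ge0.
Qed.

(** Some edge carries at least 1/N of the variation, so N sets [axis_step] with [l = t / N] cover
    the superlevel set. One factor N comes from their number, the other from 1/l. *)
Lemma weak_type_quotient (t : R) : 0 < t ->
  ((lebN \x lebN) [set z | t <= `|diff_quotient (N%:R + 1) u z|]%R <=
   t^-1%:E * ((N%:R ^+ 2 * (3 * 6 ^+ n.+2))%:E * grad_L1 u))%E.
Proof.
move=> t0; pose l := t / N%:R.
have l0 : 0 < l by rewrite divr_gt0.
have sub : [set z | t <= `|diff_quotient (N%:R + 1) u z|] `<=`
    \big[setU/set0]_(i < N) axis_step i l.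
  rewrite -(bigcup_mkord N (axis_step ^~ l)) => -[x y] /=.
  rewrite /diff_quotient/=; set r := enorm (x - y) => tq.
  (* On the diagonal the quotient is 0, hence below [t]. *)
  have r_gt0 : 0 < r.
    rewrite lt_def enorm_ge0 andbT; apply: contraTneq tq => ->.
    by rewrite powR0 ?natr1 ?pnatr_eq0// invr0 mulr0 normr0 -ltNge.
  have {}tq : t * r ^+ n.+2 <= `|u x - u y|.
    move: tq; rewrite natr1 powR_mulrn ?(ltW r_gt0)//.
    rewrite normrM normfV (ger0_norm (exprn_ge0 _ (ltW r_gt0))).
    by rewrite ler_pdivlMr ?exprn_gt0.
  apply: contrapT => nstep.
  have small i : (i < N)%N ->
      `|u (rV_mix i.+1 y x) - u (rV_mix i y x)| < l * r ^+ n.+2.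
    move=> iN; rewrite ltNge; apply/negP => le; apply: nstep.
    by exists i.
  move: tq; rewrite leNgt => /negP; apply.
  (* Telescoping along the path: [rV_mix 0 y x] is [x], and [rV_mix N y x] is [y]. *)
  have -> : u x - u y = - \sum_(0 <= i < N) (u (rV_mix i.+1 y x) - u (rV_mix i y x)).
    rewrite telescope_sumr// opprB; congr (u _ - u _).
      by apply/rowP => j; rewrite mxE.
    by apply/rowP => j; rewrite mxE ltn_ord.
  rewrite normrN; apply: (le_lt_trans (ler_norm_sum _ _ _)).
  apply: (@lt_le_trans _ _ (\sum_(0 <= i < N) l * r ^+ n.+2)).
    by apply: ltr_sum_nat.
  rewrite sumr_const_nat subn0 -mulr_natr /l le_eqVlt; apply/orP; left.
  by apply/eqP; field.
have mstep i : measurable (axis_step i l) by exact: measurable_axis_step.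
have mq : measurable_fun setT (diff_quotient (N%:R + 1) u).
  by apply: measurable_diff_quotient.
apply: (@le_trans _ _ ((lebN \x lebN)%E (\big[setU/set0]_(i < N) axis_step i l))).
  apply: le_measure; rewrite ?inE//.
  - apply: measurable_set_ler; first exact: measurable_cst.
    exact: measurableT_comp.
  - by apply: bigsetU_measurable => i _.
apply: (le_trans (@le_mu_bigsetU _ _ _ (product_sf lebN lebN) (axis_step ^~ l) N _)) => //.
apply: (@le_trans _ _ (\sum_(i < N) (3 * 6 ^+ n.+2 / l)%:E * grad_L1 u)%E).
  apply: lee_sum => i _; apply: (le_trans (axis_step_le i l0)).
  apply: lee_wpmul2l.
    by rewrite lee_fin divr_ge0 ?(ltW l0)// mulr_ge0// exprn_ge0.
  rewrite grad_L1E; apply: ge0_le_integral => //.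
  - by apply/measurable_EFinP; exact: measurableT_comp.
  - apply/measurable_EFinP; apply: (measurableT_comp (@measurable_enorm R _)).
    exact: measurable_gradient.
  - by move=> x _; rewrite lee_fin partial_le_gradient.
rewrite sume_const_ord !muleA -!EFinM.
rewrite lee_wpmul2r ?grad_L1_ge0//.
  by rewrite grad_L1E; apply: integral_ge0 => x _; rewrite lee_fin enorm_ge0.
rewrite lee_fin le_eqVlt; apply/orP; left; apply/eqP; rewrite /l.
by field; rewrite (gt_eqF t0)/= gt_eqF// ltr_pwDl.
Qed.

End weak_type.

(** * Interpolation between difference quotients, and conclusion *)

Section quotient_powers.
Variables (R : realType) (m : nat) (u : 'rV[R]_m -> R).

Lemma norm_diff_quotient (a : R) z :
  `|diff_quotient a u z| = `|u z.1 - u z.2| * enorm (z.1 - z.2) `^ (- a).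
Proof. by rewrite /diff_quotient normrM normfV (ger0_norm (powR_ge0 _ _)) powRN. Qed.

Lemma powR_diff_quotient (a r : R) z :
  `|diff_quotient a u z| `^ r =
  `|u z.1 - u z.2| `^ r / enorm (z.1 - z.2) `^ (a * r).
Proof. by rewrite norm_diff_quotient powRM ?powR_ge0// -powRrM mulNr powRN. Qed.

(** The powers of the numerator recombine because the weights add up to 1. A nonzero total exponent
    lets the powers of the distance be added on the diagonal too, where the base is 0. *)
Lemma diff_quotient_interp (a b theta : R) z : 0 < theta < 1 ->
  theta * a + (1 - theta) * b != 0 ->
  `|diff_quotient (theta * a + (1 - theta) * b) u z| =
  `|diff_quotient a u z| `^ theta * `|diff_quotient b u z| `^ (1 - theta).
Proof.
move=> /andP[t0 t1] ab0; rewrite !powR_diff_quotient mulrACA -invfM.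
rewrite -powRD; last by rewrite addrC subrK oner_eq0.
have abE : a * theta + b * (1 - theta) = theta * a + (1 - theta) * b by ring.
rewrite -powRD abE ?(negbTE ab0)// [theta + _]addrC subrK powRr1//.
by rewrite norm_diff_quotient powRN.
Qed.

End quotient_powers.

Unset Implicit Arguments.
Set Strict Implicit.

Theorem theorem5 (R : realType) (N : nat) (p1 theta : R)
    (hN : (1 <= N)%N) (hp1 : 1 < p1) (htheta : 0 < theta < 1) :
  exists C : R, forall s1 : R, 0 < s1 < 1 -> 1 <= s1 * p1 ->
    forall s p : R, s = theta * s1 + (1 - theta) ->
      p^-1 = theta / p1 + (1 - theta) ->
    [/\ 0 < s < 1, 1 < p &
      forall u : 'rV[R]_N -> R, smooth_compact_support u ->
      (lorentz_norm (lebesgue_rV R N \x lebesgue_rV R N) p (p1 / theta)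
         (diff_quotient (N%:R / p + s)%R u)
       <= C%:E * gagliardo s1 p1 u `^ theta * grad_L1 u `^ (1 - theta)%R)%E].
Proof.
case: N hN => // n _; have /andP[t0 t1] := htheta.
have p1_gt0 : 0 < p1 by exact: lt_trans hp1.
pose K : R := n.+1%:R ^+ 2 * (3 * 6 ^+ n.+2).
have K0 : 0 <= K by apply: mulr_ge0; [exact: exprn_ge0|apply: mulr_ge0; [|exact: exprn_ge0]].
(* The constant of [lorentz_hoelder], with [p] written through [theta] and [p1], times K^(1-theta)
   from the weak bound; [s1] does not occur. *)
exists ((2 * (theta / p1 + (1 - theta))^-1) `^ (p1 / theta)^-1 * 2 `^ (1 - theta) *
  K `^ (1 - theta)).
move=> s1 /andP[s10 s11] _ s p sE pE.
have t1' : 0 < 1 - theta by rewrite subr_gt0.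
have p_gt0 : 0 < p by rewrite -invr_gt0 pE addr_gt0// divr_gt0.
have s0 : 0 < s by rewrite sE addr_gt0// mulr_gt0.
have slt1 : s < 1.
  by rewrite sE -ltrBrDr opprB addrCA subrr addr0 gtr_pMr.
have p_gt1 : 1 < p.
  rewrite -invf_lt1// pE -ltrBrDr opprB addrCA subrr addr0.
  by rewrite ltr_pdivrMr// ltr_pMr.
split => // [|u [su _]]; first by rewrite s0.
have mu : measurable_fun setT u by apply: continuous_rV_measurable; exact: (su [::]).1.
have mq a : measurable_fun setT (fun z => `|diff_quotient a u z|).
  by apply: measurableT_comp => //; exact: measurable_diff_quotient.
(* The exponent is the mean, with weights [theta] and [1 - theta], of the Gagliardo exponent and the
   weak-type exponent. *)
have aE : n.+1%:R / p + s =
    theta * (n.+1%:R / p1 + s1) + (1 - theta) * (n.+1%:R + 1).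
  by rewrite sE pE; ring.
have a0 : 0 < n.+1%:R / p + s by rewrite addr_gt0// divr_gt0.
(* Since (N/p1 + s1) p1 = N + s1 p1, the semi-norm is the L^p1 norm of the quotient. *)
have gagE : gagliardo s1 p1 u = ((\int[lebesgue_rV R n.+1 \x lebesgue_rV R n.+1]_z
    (`|diff_quotient (n.+1%:R / p1 + s1) u z| `^ p1)%:E) `^ p1^-1)%E.
  rewrite /gagliardo; congr (_ `^ _)%E; apply: eq_integral => z _.
  by rewrite powR_diff_quotient mulrDl divfK ?gt_eqF.
rewrite aE gagE -pE invrK.
have grad0 : (0 <= grad_L1 u)%E.
  by rewrite grad_L1E//; apply: integral_ge0 => x _; rewrite lee_fin enorm_ge0.
have LH := @lorentz_hoelder _ _ _
  (product_sf (lebesgue_rV R n.+1) (lebesgue_rV R n.+1)) p1 theta p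
  (diff_quotient (theta * (n.+1%:R / p1 + s1) + (1 - theta) * (n.+1%:R + 1)) u)
  (fun z => `|diff_quotient (n.+1%:R + 1) u z|)
  (fun z => `|diff_quotient (n.+1%:R / p1 + s1) u z|) hp1 htheta pE.
apply: (le_trans (LH _ _ _ _ _ _ (K%:E * grad_L1 u)%E _ _)) => //.
- exact: measurable_diff_quotient.
- by move=> z; apply: diff_quotient_interp => //; rewrite -aE gt_eqF.
- by rewrite mule_ge0.
- by move=> t tgt0; exact: weak_type_quotient.
rewrite poweRM// poweR_EFin (EFinM _ (K `^ (1 - theta))) -!muleA.
by rewrite [X in (_ * X <= _)%E]muleCA.
Qed.
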